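(* Let $\mathsf{k}$ be an algebraically closed field and let $A$ be any finite-dimensional $\mathsf{k}$-algebra. Then $$\mathsf{FPdim}\big(A\otimes_{\mathsf k}\mathsf{k}[x]/(x^m)\big)=\mathsf{FPdim}(A)+1\quad\text{for every integer } m\ge2,$$ and $$\mathsf{FPdim}\big(\mathsf{k}[x_1,\dots,x_n]/(x_1^2,\dots,x_n^2)\big)=n\quad\text{for every integer } n\ge 1.$$ In particular, every non-negative integer occurs as the Frobenius--Perron dimension of some finite-dimensional $\mathsf{k}$-algebra.
   Context: $\mathsf{k}$ is an algebraically closed field. An algebra means a (nonzero, unital, associative) finite-dimensional $\mathsf{k}$-algebra, not assumed connected; modules are finitely generated right modules, and $\mathsf{mod}\,A$ is the category of such $A$-modules. A module $S$ is a brick if $\mathrm{End}_A(S)$ is a division ring (equivalently $\mathrm{End}_A(S)\simeq\mathsf{k}$). A semibrick is a (possibly empty) set $\mathcal S$ of pairwise non-isomorphic bricks with $\mathrm{Hom}_A(S,S')=0$ for all non-isomorphic $S,S'\in\mathcal S$. For a finite semibrick $\mathcal S$, the $\mathrm{Ext}$-quiver $Q_{\mathcal S}$ has vertex set $\mathcal S$ and exactly $\dim_{\mathsf k}\mathrm{Ext}^1_A(S,S')$ arrows from $S$ to $S'$ (loops included). For a quiver $Q$, $\rho(Q)$ is the spectral radius (largest modulus of an eigenvalue) of its adjacency matrix, with $\rho=0$ for the empty quiver. The Frobenius--Perron dimension of $A$ is $\mathsf{FPdim}(A)=\sup\{\rho(Q_{\mathcal S})\mid \mathcal S \text{ a finite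 semibrick in } \mathsf{mod}\,A\}\in[0,\infty]$. *)

(* Defs.v *)
From HB Require Import structures.
From mathcomp Require Import all_boot all_order all_algebra all_field.
From mathcomp Require Import generic_quotient ring_quotient mpoly complex.
From mathcomp Require Import boolp classical_sets reals constructive_ereal ereal.

Set Implicit Arguments.
Unset Strict Implicit.
Unset Printing Implicit Defensive.

Import Order.TTheory GRing.Theory Num.Theory.

Local Open Scope ring_scope.
Local Open Scope classical_set_scope.

(* Right A-modules are left modules over the converse ring A^c: the right
   action m . a is written (a : A^c) *: m, and Hom_A(M, N) is
   {linear M -> N}.  The scalar c in K acts on M through c%:A. *)

Section Modules.
Variables (K : fieldType) (A : falgType K).
Implicit Types M N L : lmodType A^c.

Definition finitely_generated M : Prop :=
  exists n (g : 'I_n -> M),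
    forall v, exists c : 'I_n -> A^c, v = \sum_i c i *: g i.

Record fgmod := FGMod {
  fgmod_sort :> lmodType A^c;
  fgmodP : finitely_generated fgmod_sort }.

Definition mod_iso M N : Prop := exists f : {linear M -> N}, bijective f.

Definition brick M : Prop :=
  (exists v : M, v != 0) /\
  forall f : {linear M -> M}, ~ (forall v, f v = 0) ->
    exists g : {linear M -> M}, cancel f g /\ cancel g f.

(* A finite semibrick, enumerated without repetition. *)
Definition semibrick n (S : 'I_n -> fgmod) : Prop :=
  (forall i, brick (S i)) /\
  forall i j, i != j ->
    ~ mod_iso (S i) (S j) /\ forall (f : {linear S i -> S j}) v, f v = 0.

Definition projective L : Prop :=
  forall M N (g : {linear M -> N}) (f : {linear L -> N}),
    (forall y, exists x, g x = y) ->
    exists h : {linear L -> M}, forall x, g (h x) = f x.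

Definition exact_at L M N (f : {linear L -> M}) (g : {linear M -> N}) : Prop :=
  forall y, g y = 0 <-> exists x, f x = y.

(* The degree-one cohomology of Hom_A(P0, N) -> Hom_A(P1, N) -> Hom_A(P2, N)
   has K-dimension d: the cocycles z_0, ..., z_{d-1} induce a K-basis of the
   quotient of the cocycles by the coboundaries h \o d1. *)
Definition cohomology1_dim (P0 P1 P2 N : lmodType A^c)
    (d1 : {linear P1 -> P0}) (d2 : {linear P2 -> P1}) (d : nat) : Prop :=
  exists z : 'I_d -> {linear P1 -> N},
    (forall i x, z i (d2 x) = 0) /\
    forall f : {linear P1 -> N}, (forall x, f (d2 x) = 0) ->
      exists! c : 'rV[K]_d, exists h : {linear P0 -> N},
        forall x, f x = \sum_i ((c 0 i)%:A : A^c) *: z i x + h (d1 x).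

(* Ext^1_A(M, N) has K-dimension d.  Only the beginning
   P2 -> P1 -> P0 -> M -> 0 of a projective resolution of M matters. *)
Definition has_ext1_dim M N (d : nat) : Prop :=
  exists (P0 P1 P2 : fgmod) (e : {linear P0 -> M})
         (d1 : {linear P1 -> P0}) (d2 : {linear P2 -> P1}),
    [/\ [/\ projective P0, projective P1 & projective P2],
        (forall y, exists x, e x = y), exact_at d1 e, exact_at d2 d1 &
        cohomology1_dim N d1 d2 d].

(* For finitely generated M and N there is exactly one such d, so the default
   value 0 of xget is never used. *)
Definition ext1_dim M N : nat := xget 0%N [set d | has_ext1_dim M N d].

Definition ext_quiver n (S : 'I_n -> fgmod) : 'M[nat]_n :=
  \matrix_(i, j) ext1_dim (S i) (S j).

End Modules.

Section FPdim.
Variable R : realType.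

(* For n = 0 this is sup set0 = 0, see spectral_radius0. *)
Definition spectral_radius n (a : 'M[nat]_n) : R :=
  sup [set Normc.normc l | l in
        [set l : R[i] | eigenvalue (map_mx (fun k : nat => k%:R) a) l]].

Lemma spectral_radius0 (a : 'M[nat]_0) : spectral_radius a = 0.
Proof.
rewrite /spectral_radius (_ : [set _ | _ in _] = set0) ?sup0 //.
apply/seteqP; split=> // r [l /=].
by case/eigenvalueP=> v _; rewrite thinmx0 eqxx.
Qed.

Definition FPdim (K : fieldType) (A : falgType K) : \bar R :=
  ereal_sup [set r | exists n (S : 'I_n -> fgmod A),
               semibrick S /\ r = (spectral_radius (ext_quiver S))%:E].

End FPdim.

(* The tensor product of two finite-dimensional algebras, in coordinates: the
   (i, j) entry is the coefficient of e_i (x) f_j, for the bases (e_i) of A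
   and (f_j) of B given by vbasis. *)

Section Tensor.
Variables (K : fieldType) (A B : falgType K).

Let eA (i : 'I_(\dim {:A})) : A := (vbasis {:A})`_i.
Let eB (j : 'I_(\dim {:B})) : B := (vbasis {:B})`_j.

Definition tensor := 'M[K]_(\dim {:A}, \dim {:B}).

HB.instance Definition _ :=
  Vector.copy tensor 'M[K]_(\dim {:A}, \dim {:B}).

Definition tpure (a : A) (b : B) : tensor :=
  \matrix_(i, j) (coord (vbasis {:A}) i a * coord (vbasis {:B}) j b).

Definition tensor_one : tensor := tpure 1 1.

Definition tensor_mul (t u : tensor) : tensor :=
  \sum_i \sum_j \sum_k \sum_l
    (t i j * u k l) *: tpure (eA i * eA k) (eB j * eB l).

Fact tpure_linearl b : linear (tpure ^~ b).
Proof.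
by move=> c x y; apply/matrixP=> i j; rewrite !mxE linearP mulrDl mulrA.
Qed.

Fact tpure_linearr a : linear (tpure a).
Proof.
by move=> c x y; apply/matrixP=> i j; rewrite !mxE linearP mulrDr mulrCA.
Qed.

Lemma tpure_sumr a (I : finType) (F : I -> K) (G : I -> B) :
  tpure a (\sum_i F i *: G i) = \sum_i F i *: tpure a (G i).
Proof.
pose f := GRing.isLinear.Build _ _ _ _ (tpure a) (tpure_linearr a).
pose L : {linear B -> tensor} := HB.pack (tpure a) f.
rewrite -[tpure a _]/(L _) linear_sum; apply: eq_bigr => i _.
by rewrite linearZ.
Qed.

Lemma tpure_suml b (I : finType) (F : I -> K) (G : I -> A) :
  tpure (\sum_i F i *: G i) b = \sum_i F i *: tpure (G i) b.
Proof.
pose f := GRing.isLinear.Build _ _ _ _ (tpure ^~ b) (tpure_linearl b).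
pose L : {linear A -> tensor} := HB.pack (tpure ^~ b) f.
rewrite -[tpure _ b]/(L _) linear_sum; apply: eq_bigr => i _.
by rewrite linearZ.
Qed.

Lemma tpure_basis i j : tpure (eA i) (eB j) = delta_mx i j.
Proof.
apply/matrixP=> k l; rewrite !mxE /eA /eB.
rewrite !coord_free ?(basis_free (vbasisP _)) //.
by rewrite -natrM mulnb eq_sym [j == l]eq_sym.
Qed.

Lemma tensor_decomp (t : tensor) :
  t = \sum_i \sum_j t i j *: tpure (eA i) (eB j).
Proof.
rewrite {1}[t]matrix_sum_delta; apply: eq_bigr => i _.
by apply: eq_bigr => j _; rewrite tpure_basis.
Qed.

Fact tensor_mull t : linear (tensor_mul t).
Proof.
move=> c u v; rewrite /tensor_mul scaler_sumr -big_split /=.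
apply: eq_bigr => i _; rewrite scaler_sumr -big_split /=.
apply: eq_bigr => j _; rewrite scaler_sumr -big_split /=.
apply: eq_bigr => k _; rewrite scaler_sumr -big_split /=.
apply: eq_bigr => l _; rewrite !mxE scalerA -scalerDl.
by congr (_ *: _); rewrite mulrDr mulrCA.
Qed.

Fact tensor_mulr u : linear (tensor_mul ^~ u).
Proof.
move=> c t v; rewrite /tensor_mul scaler_sumr -big_split /=.
apply: eq_bigr => i _; rewrite scaler_sumr -big_split /=.
apply: eq_bigr => j _; rewrite scaler_sumr -big_split /=.
apply: eq_bigr => k _; rewrite scaler_sumr -big_split /=.
apply: eq_bigr => l _; rewrite !mxE scalerA -scalerDl.
by congr (_ *: _); rewrite mulrDl mulrA.
Qed.

Lemma tensor_mul_pure a b a' b' :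
  tensor_mul (tpure a b) (tpure a' b') = tpure (a * a') (b * b').
Proof.
rewrite [in RHS](coord_vbasis (memvf a)) [in RHS](coord_vbasis (memvf b)).
rewrite mulr_suml (eq_bigr (fun i =>
  coord (vbasis {:A}) i a *: (eA i * a'))); last first.
  by move=> i _; rewrite -scalerAl.
rewrite tpure_suml; apply: eq_bigr => i _.
rewrite mulr_suml (eq_bigr (fun j =>
  coord (vbasis {:B}) j b *: (eB j * b'))); last first.
  by move=> j _; rewrite -scalerAl.
rewrite tpure_sumr scaler_sumr; apply: eq_bigr => j _.
rewrite [in RHS](coord_vbasis (memvf a')) [in RHS](coord_vbasis (memvf b')).
rewrite mulr_sumr (eq_bigr (fun k =>
  coord (vbasis {:A}) k a' *: (eA i * eA k))); last first.
  by move=> k _; rewrite -scalerAr.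
rewrite tpure_suml scalerA scaler_sumr; apply: eq_bigr => k _.
rewrite mulr_sumr (eq_bigr (fun l =>
  coord (vbasis {:B}) l b' *: (eB j * eB l))); last first.
  by move=> l _; rewrite -scalerAr.
rewrite tpure_sumr scalerA scaler_sumr; apply: eq_bigr => l _.
by rewrite !mxE !scalerA; congr (_ *: _); rewrite !mulrA.
Qed.

Lemma tensor_ind (P : tensor -> Prop) :
  (forall c t u, P t -> P u -> P (c *: t + u)) ->
  (forall a b, P (tpure a b)) -> forall t, P t.
Proof.
move=> PD Pp.
have P0 : P 0 by rewrite -(addNr (tpure 0 0)) -scaleN1r; exact: PD.
move=> t; rewrite [t]tensor_decomp.
elim/big_ind: _ => // [x y Px Py|i _]; first by rewrite -[x]scale1r; apply: PD.
elim/big_ind: _ => // [x y Px Py|j _]; first by rewrite -[x]scale1r; apply: PD.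
by rewrite -[_ *: _]addr0; apply: PD.
Qed.

Fact tensor_mulDl : left_distributive tensor_mul +%R.
Proof.
by move=> t u v; have := tensor_mulr v 1 t u; rewrite !scale1r.
Qed.

Fact tensor_mulDr : right_distributive tensor_mul +%R.
Proof.
by move=> t u v; have := tensor_mull t 1 u v; rewrite !scale1r.
Qed.

Fact tensor_mulA : associative tensor_mul.
Proof.
move=> t u v; elim/tensor_ind: t => [c t t' IH IH'|a b].
  by rewrite !(tensor_mulr, IH, IH').
elim/tensor_ind: u => [c u u' IH IH'|a' b'].
  by rewrite !(tensor_mulr, tensor_mull, IH, IH').
elim/tensor_ind: v => [c v v' IH IH'|a'' b''].
  by rewrite !(tensor_mull, IH, IH').
by rewrite !tensor_mul_pure !mulrA.
Qed.

Fact tensor_mul1l : left_id tensor_one tensor_mul.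
Proof.
move=> t; elim/tensor_ind: t => [c t t' IH IH'|a b].
  by rewrite tensor_mull IH IH'.
by rewrite tensor_mul_pure !mul1r.
Qed.

Fact tensor_mul1r : right_id tensor_one tensor_mul.
Proof.
move=> t; elim/tensor_ind: t => [c t t' IH IH'|a b].
  by rewrite tensor_mulr IH IH'.
by rewrite tensor_mul_pure !mulr1.
Qed.

Fact tensor_one_neq0 : tensor_one != 0.
Proof.
have coord_neq0 (V : falgType K) : exists i, coord (vbasis {:V}) i 1 != 0.
  apply/existsP; rewrite -[[exists _, _]]negbK negb_exists; apply/forallP => c0.
  have /eqP[] := oner_neq0 V; rewrite [LHS](coord_vbasis (memvf 1)).
  by apply: big1 => i _; rewrite (eqP (negbNE (c0 i))) scale0r.
have [i i0] := coord_neq0 A; have [j j0] := coord_neq0 B.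
apply/eqP=> /matrixP/(_ i j); rewrite !mxE => /eqP.
by rewrite mulf_eq0 (negPf i0) (negPf j0).
Qed.

HB.instance Definition _ := GRing.Zmodule_isNzRing.Build tensor
  tensor_mulA tensor_mul1l tensor_mul1r tensor_mulDl tensor_mulDr
  tensor_one_neq0.

Fact tensor_scalerAl c (t u : tensor) : c *: (t * u) = (c *: t) * u.
Proof.
have m0 : tensor_mul 0 u = 0 by rewrite -[LHS]/(0 * u) mul0r.
by have := tensor_mulr u c t 0; rewrite m0 !addr0.
Qed.

HB.instance Definition _ :=
  GRing.Lmodule_isLalgebra.Build K tensor tensor_scalerAl.

Fact tensor_scalerAr c (t u : tensor) : c *: (t * u) = t * (c *: u).
Proof.
have m0 : tensor_mul t 0 = 0 by rewrite -[LHS]/(t * 0) mulr0.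
by have := tensor_mull t c u 0; rewrite m0 !addr0.
Qed.

HB.instance Definition _ :=
  GRing.Lalgebra_isAlgebra.Build K tensor tensor_scalerAr.

HB.instance Definition _ := Algebra_isFalgebra.Build K tensor.

Lemma tpure1 : tpure 1 1 = 1. Proof. by []. Qed.

Lemma tpureM a b a' b' : tpure a b * tpure a' b' = tpure (a * a') (b * b').
Proof. exact: tensor_mul_pure. Qed.

End Tensor.

(* This is K[x]/(x^m) only for m > 0: by convention {poly %/ 'X^0} is K[x]/(x). *)

Definition truncated_poly (K : fieldType) (m : nat) := {poly %/ 'X^m : {poly K}}.

HB.instance Definition _ (K : fieldType) m :=
  GRing.UnitAlgebra.on (truncated_poly K m).
HB.instance Definition _ (K : fieldType) m :=
  Vector.on (truncated_poly K m).

Section SquareZero.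
Variables (K : fieldType) (n : nat).

(* The ideal (x_1^2, ..., x_n^2), made boolean by asbool as ring_quotient
   requires. *)
Definition square_ideal (p : {mpoly K[n]}) : bool :=
  `[< exists q : 'I_n -> {mpoly K[n]}, p = \sum_i q i * 'X_i ^+ 2 >].

Lemma square_idealP p : reflect
  (exists q : 'I_n -> {mpoly K[n]}, p = \sum_i q i * 'X_i ^+ 2)
  (p \in square_ideal).
Proof. exact: asboolP. Qed.

Definition squarefree_mnm (s : {set 'I_n}) : 'X_{1..n} :=
  [multinom (i \in s : nat) | i < n].

Fact square_ideal_add : {in square_ideal &, forall p q, p + q \in square_ideal}.
Proof.
move=> _ _ /square_idealP[f ->] /square_idealP[g ->]; apply/square_idealP.
exists (fun i => f i + g i); rewrite -big_split /=.
by apply: eq_bigr => i _; rewrite mulrDl.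
Qed.

Fact square_ideal_mul u : {in square_ideal, forall p, u * p \in square_ideal}.
Proof.
move=> _ /square_idealP[f ->]; apply/square_idealP.
exists (fun i => u * f i); rewrite mulr_sumr.
by apply: eq_bigr => i _; rewrite mulrA.
Qed.

Fact square_ideal0 : 0 \in square_ideal.
Proof.
by apply/square_idealP; exists (fun=> 0); rewrite big1 // => i; rewrite mul0r.
Qed.

Lemma mem_square_ideal p :
  reflect (forall s, p@_(squarefree_mnm s) = 0) (p \in square_ideal).
Proof.
apply: (iffP idP) => [/square_idealP[q ->] s | p0].
  rewrite raddf_sum /= big1 // => i _; rewrite mpolyXn.
  apply: memN_msupp_eq0; rewrite (perm_mem (msuppMX _ _)).
  apply/mapP=> -[m _] /mnmP/(_ i); rewrite mnmE mnmDE mulmnE mnm1E eqxx.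
  by case: (i \in s).
rewrite [p]mpolyE big_seq; elim/big_ind: _ => [|x y|m].
- exact: square_ideal0.
- exact: square_ideal_add.
rewrite mcoeff_msupp => pm; have [i mi] : exists i, (1 < m i)%N.
  apply/existsP; apply: contraNT pm; rewrite negb_exists => /forallP m1.
  rewrite -(p0 (finset.finset (fun i => m i == 1%N))); apply/eqP; congr (p@__).
  apply/mnmP=> i; rewrite mnmE inE; move: (m1 i).
  by case: (m i) => [|[]].
rewrite -mul_mpolyC; apply: square_ideal_mul.
have -> : m = ((m - U_(i) *+ 2) + U_(i) *+ 2)%MM.
  rewrite submK //; apply/mnm_lepP=> j; rewrite mulmnE mnm1E.
  by case: eqP => [<-|].
rewrite mpolyXD -mpolyXn; apply: square_ideal_mul.
apply/square_idealP; exists (fun j => (i == j)%:R).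
rewrite (bigD1 i) //= eqxx mul1r big1 ?addr0 // => j /negPf ji.
by rewrite eq_sym ji mul0r.
Qed.

Fact square_ideal_closed : idealr_closed square_ideal.
Proof.
split=> [||u p q pI qI]; first exact: square_ideal0.
  apply/negP=> /mem_square_ideal/(_ finset.set0)/eqP.
  rewrite mcoeff1 (_ : squarefree_mnm _ = 0%MM) ?eqxx ?oner_eq0 //.
  by apply/mnmP=> i; rewrite !mnmE inE.
by apply: square_ideal_add => //; apply: square_ideal_mul.
Qed.

HB.instance Definition _ :=
  isIdealr.Build {mpoly K[n]} square_ideal square_ideal_closed.

Definition square_zero_alg :=
  {ideal_quot (square_ideal : idealr {mpoly K[n]})}.

HB.instance Definition _ := GRing.ComNzRing.on square_zero_alg.

Local Notation Q := square_zero_alg.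

Definition square_zero_proj (p : {mpoly K[n]}) : Q := \pi_Q%qT p.

Fact square_zero_proj_eq p q :
  square_zero_proj p = square_zero_proj q <-> p - q \in square_ideal.
Proof.
rewrite (Quotient.idealrBE (square_ideal : idealr {mpoly K[n]}) p q).
by split=> [/eqP|/eqP].
Qed.

Fact square_zero_projK : cancel repr square_zero_proj.
Proof. exact: reprK. Qed.

Fact square_zero_projB p q :
  square_zero_proj (p - q) = square_zero_proj p - square_zero_proj q.
Proof. exact: rmorphB. Qed.

Fact square_zero_projD p q :
  square_zero_proj (p + q) = square_zero_proj p + square_zero_proj q.
Proof. exact: rmorphD. Qed.

Fact square_zero_projM p q :
  square_zero_proj (p * q) = square_zero_proj p * square_zero_proj q.
Proof. exact: rmorphM. Qed.

Definition square_zero_scale (c : K) (x : Q) : Q :=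
  square_zero_proj (c *: repr x).

Fact square_zero_scaleE c p :
  square_zero_scale c (square_zero_proj p) = square_zero_proj (c *: p).
Proof.
apply/square_zero_proj_eq; rewrite -scalerBr -mul_mpolyC.
apply: square_ideal_mul; apply/square_zero_proj_eq.
by rewrite square_zero_projK.
Qed.

Fact square_zero_scalerA a b x :
  square_zero_scale a (square_zero_scale b x) = square_zero_scale (a * b) x.
Proof.
by rewrite -[x]square_zero_projK !square_zero_scaleE scalerA.
Qed.

Fact square_zero_scale1r : left_id 1 square_zero_scale.
Proof.
by move=> x; rewrite -[x]square_zero_projK square_zero_scaleE scale1r.
Qed.

Fact square_zero_scalerDr : right_distributive square_zero_scale +%R.
Proof.
move=> c x y; rewrite -[x]square_zero_projK -[y]square_zero_projK.
by rewrite -square_zero_projD !square_zero_scaleE scalerDr square_zero_projD.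
Qed.

Fact square_zero_scalerDl x :
  {morph square_zero_scale^~ x : a b / a + b}.
Proof.
move=> a b; rewrite -[x]square_zero_projK !square_zero_scaleE.
by rewrite scalerDl square_zero_projD.
Qed.

HB.instance Definition _ := GRing.Zmodule_isLmodule.Build K Q
  square_zero_scalerA square_zero_scale1r square_zero_scalerDr
  square_zero_scalerDl.

Fact square_zero_scalerAl c (x y : Q) : c *: (x * y) = (c *: x) * y.
Proof.
rewrite -[x]square_zero_projK -[y]square_zero_projK -square_zero_projM.
rewrite -![c *: _]/(square_zero_scale c _) !square_zero_scaleE.
by rewrite -square_zero_projM scalerAl.
Qed.

HB.instance Definition _ :=
  GRing.Lmodule_isLalgebra.Build K Q square_zero_scalerAl.

Fact square_zero_scalerAr c (x y : Q) : c *: (x * y) = x * (c *: y).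
Proof. by rewrite mulrC scalerAl mulrC. Qed.

HB.instance Definition _ :=
  GRing.Lalgebra_isAlgebra.Build K Q square_zero_scalerAr.

Definition square_zero_coord (x : Q) : 'rV[K]_#|{set 'I_n}| :=
  \row_k (repr x)@_(squarefree_mnm (enum_val k)).

Fact square_zero_coordE p :
  square_zero_coord (square_zero_proj p) =
  \row_k p@_(squarefree_mnm (enum_val k)).
Proof.
apply/rowP=> k; rewrite !mxE; apply/eqP; rewrite -subr_eq0 -raddfB /=.
apply/eqP; move: (enum_val k) => s; apply: (mem_square_ideal _ _).
by apply/square_zero_proj_eq; rewrite square_zero_projK.
Qed.

Fact square_zero_vect : Vector.axiom #|{set 'I_n}| Q.
Proof.
exists square_zero_coord => [c x y|].
  rewrite -[x]square_zero_projK -[y]square_zero_projK.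
  rewrite -[c *: _]/(square_zero_scale c _) square_zero_scaleE.
  rewrite -square_zero_projD !square_zero_coordE.
  by apply/rowP=> k; rewrite !mxE mcoeffD mcoeffZ.
pose comb (r : 'rV[K]_#|{set 'I_n}|) : {mpoly K[n]} :=
  \sum_k r 0 k *: 'X_[squarefree_mnm (enum_val k)].
have combE r k : (comb r)@_(squarefree_mnm (enum_val k)) = r 0 k.
  rewrite raddf_sum (bigD1 k) //= mcoeffZ mcoeffX eqxx mulr1 big1 ?addr0 //.
  move=> l lk; rewrite mcoeffZ mcoeffX; case: eqP => [e|]; last by rewrite mulr0.
  case/eqP: lk; apply: enum_val_inj; apply/setP=> i.
  by have /mnmP/(_ i) := e; rewrite !mnmE; do 2!case: (i \in _).
exists (fun r => square_zero_proj (comb r)) => [x|r].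
  rewrite -[x]square_zero_projK square_zero_coordE.
  apply/square_zero_proj_eq/mem_square_ideal => s.
  by rewrite mcoeffB -[s]enum_rankK combE mxE subrr.
by rewrite square_zero_coordE; apply/rowP=> k; rewrite mxE combE.
Qed.

HB.instance Definition _ := Lmodule_hasFinDim.Build K Q square_zero_vect.
HB.instance Definition _ := Algebra_isFalgebra.Build K Q.

End SquareZero.

(* Main.v *)
(** Let x be a central nilpotent element of A'. It acts on a brick by an
    endomorphism that is not invertible, hence by 0, so adjoining such
    variables to A changes neither bricks nor semibricks. Identify
    Ext^1_A(M, N) with the derivations A -> Hom_K(M, N) modulo the inner
    ones. A derivation of A' amounts to a derivation of A together with, for
    each new variable x, its value at x, which is an arbitrary A-linear map
    M -> N. On a semibrick Hom_A(S, S') is K or 0, so each variable adds the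
    identity matrix to the adjacency matrix of the Ext-quiver. By Perron-
    Frobenius the spectral radius of a nonnegative matrix is itself an
    eigenvalue, so that adding n times the identity raises it by n. The
    second formula is the case A = K, for which all Ext^1 vanish.

    For Perron-Frobenius, let l be an eigenvalue of b >= 0 with eigenvector
    v; then |v| b >= |l| |v|. If b had no real eigenvalue t >= |l|, then t -
    b would stay inverse-positive from large t down to |l|, which forces |v|
    <= 0. *)

Require Import Defs.
From mathcomp Require Import all_boot all_order all_algebra all_field.
From mathcomp Require Import reals constructive_ereal.
From HB Require Import structures.
From mathcomp Require Import generic_quotient ring_quotient complex.
From mathcomp Require Import -(notations) mpoly.
From mathcomp Require Import boolp classical_sets functions.
From mathcomp Require Import ereal topology normedtype derive.

Set Implicit Arguments.
Unset Strict Implicit.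
Unset Printing Implicit Defensive.

Import Order.TTheory GRing.Theory Num.Theory.
Import numFieldNormedType.Exports.

Local Open Scope ring_scope.

Definition lin_of (R : pzRingType) (U V : lmodType R) (f : U -> V)
    (fP : linear f) : {linear U -> V} :=
  HB.pack f (GRing.isLinear.Build R U V _ f fP).

Lemma lin_ofE (R : pzRingType) (U V : lmodType R) (f : U -> V) (fP : linear f) x :
  lin_of fP x = f x.
Proof. by []. Qed.

(** * Subspaces and quotient dimensions *)

Section QuotientDimension.
Variable K : fieldType.

(** Subspaces are predicates because the ambient spaces, such as all functions [A -> M -> N], may be
    infinite-dimensional. *)
Definition subsp (X : lmodType K) (Z : X -> Prop) : Prop :=
  Z 0 /\ forall c x y, Z x -> Z y -> Z (c *: x + y).

Definition qdim (X : lmodType K) (Z B : X -> Prop) (d : nat) : Prop :=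
  exists z : 'I_d -> X, (forall i, Z (z i)) /\
    forall x, Z x -> exists! c : 'rV[K]_d, B (x - \sum_i c 0 i *: z i).

Lemma subspD (X : lmodType K) (Z : X -> Prop) : subsp Z ->
  forall x y, Z x -> Z y -> Z (x + y).
Proof. by move=> [_ ZD] x y Zx Zy; rewrite -[x]scale1r; apply: ZD. Qed.

Lemma subspZ (X : lmodType K) (Z : X -> Prop) : subsp Z ->
  forall c x, Z x -> Z (c *: x).
Proof. by move=> [Z0 ZD] c x Zx; rewrite -[_ *: x]addr0; apply: ZD. Qed.

Lemma subspN (X : lmodType K) (Z : X -> Prop) : subsp Z ->
  forall x, Z x -> Z (- x).
Proof. by move=> sZ x Zx; rewrite -scaleN1r; apply: subspZ. Qed.

Lemma subspB (X : lmodType K) (Z : X -> Prop) : subsp Z ->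
  forall x y, Z x -> Z y -> Z (x - y).
Proof. by move=> sZ x y Zx Zy; apply: subspD => //; apply: subspN. Qed.

Lemma subsp_sum (X : lmodType K) (Z : X -> Prop) : subsp Z ->
  forall (I : finType) (c : I -> K) (z : I -> X),
  (forall i, Z (z i)) -> Z (\sum_i c i *: z i).
Proof.
move=> sZ I c z Zz; elim/big_ind: _ => [|x y|i _]; first by case: sZ.
  exact: subspD.
exact: subspZ.
Qed.

(** Expanding each family in the other gives matrices [D] and [C]; by uniqueness of coordinates
    modulo [B] their product is the identity, which bounds [d1] by [d2]. *)
Lemma qdim_uniq (X : lmodType K) (Z B : X -> Prop) d d' : subsp B ->
  qdim Z B d -> qdim Z B d' -> d = d'.
Proof.
move=> sB.
suff le d1 d2 : qdim Z B d1 -> qdim Z B d2 -> (d1 <= d2)%N.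
  by move=> q q'; apply/eqP; rewrite eqn_leq !le.
move=> [z [Zz zP]] [z' [Zz' zP']].
have [C CP] := choice (fun j => zP _ (Zz' j)).
have [D DP] := choice (fun i => zP' _ (Zz i)).
apply: (@mulmx1_min _ _ _ (\matrix_(i, j) D i 0 j) (\matrix_(j, k) C j 0 k)).
apply/row_matrixP=> i; have [c [_ cU]] := zP _ (Zz i).
rewrite -(cU (row i 1%:M)); last first.
  rewrite (bigD1 i) //= !mxE eqxx scale1r big1 ?addr0 ?subrr; first by case: sB.
  by move=> j /negPf ji; rewrite !mxE eq_sym ji scale0r.
apply/esym/cU.
have -> : z i - \sum_k (row i (\matrix_(i, j) D i 0 j *m \matrix_(j, k) C j 0 k))
    0 k *: z k = (z i - \sum_j D i 0 j *: z' j) +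
    \sum_j D i 0 j *: (z' j - \sum_k C j 0 k *: z k).
  have -> : \sum_j D i 0 j *: (z' j - \sum_k C j 0 k *: z k) =
      \sum_j D i 0 j *: z' j - \sum_j \sum_k D i 0 j *: (C j 0 k *: z k).
    by rewrite -sumrB; apply: eq_bigr => j _; rewrite scalerBr scaler_sumr.
  rewrite addrA subrK exchange_big /=; congr (_ - _).
  apply: eq_bigr => k _; rewrite !mxE scaler_suml; apply: eq_bigr => j _.
  by rewrite !mxE scalerA.
by apply: subspD => //; [case: (DP i) | apply: subsp_sum => // j; case: (CP j)].
Qed.

(** The conditions on [Phi] say that it induces an isomorphism from [Z] modulo [B] onto [Z'] modulo
    [B'], so it carries a basis to a basis. *)
Lemma qdim_transfer (X Y : lmodType K) (Phi : {linear X -> Y})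
    (Z B : X -> Prop) (Z' B' : Y -> Prop) d : subsp Z -> subsp B' ->
  (forall x, Z x -> Z' (Phi x)) ->
  (forall y, Z' y -> exists2 x, Z x & B' (y - Phi x)) ->
  (forall x, Z x -> (B x <-> B' (Phi x))) ->
  qdim Z B d -> qdim Z' B' d.
Proof.
move=> sZ sB' ZZ' surj BB' [z [Zz zP]].
have PhiS x (c : 'rV[K]_d) : Phi (x - \sum_i c 0 i *: z i) =
    Phi x - \sum_i c 0 i *: Phi (z i).
  rewrite linearB linear_sum; congr (_ - _).
  by apply: eq_bigr => i _; rewrite linearZ.
exists (fun i => Phi (z i)); split=> [i|y /surj[x Zx yx]]; first exact: ZZ'.
have ZS (c : 'rV[K]_d) : Z (x - \sum_i c 0 i *: z i).
  by apply: subspB => //; apply: subsp_sum.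
have [c [Bc cU]] := zP x Zx; exists c; split=> [|c' Bc'].
  have -> : y - \sum_i c 0 i *: Phi (z i) = y - Phi x +
    Phi (x - \sum_i c 0 i *: z i) by rewrite PhiS addrA subrK.
  by apply: subspD => //; apply/BB'.
apply: cU; apply/BB' => //; rewrite PhiS.
have -> : Phi x - \sum_i c' 0 i *: Phi (z i) =
  (y - \sum_i c' 0 i *: Phi (z i)) - (y - Phi x).
  by rewrite opprB [RHS]addrC addrA subrK.
exact: subspB.
Qed.

(** A subspace of maximal dimension inside [P] exhausts [P]: a vector of [P] outside it would
    enlarge it. *)
Lemma vspace_of_subsp (V : vectType K) (P : V -> Prop) : subsp P ->
  exists U : {vspace V}, forall v, v \in U <-> P v.
Proof.
move=> sP; pose T d := `[< exists U : {vspace V},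
  \dim U = d /\ forall v, v \in U -> P v >].
have exT : exists d, T d.
  exists 0%N; apply/asboolP; exists 0%VS; split; first by rewrite dimv0.
  by move=> v; rewrite memv0 => /eqP->; case: sP.
have leT d : T d -> (d <= \dim {:V})%N.
  by move=> /asboolP[U [<- _]]; apply/dimvS/subvf.
case: (ex_maxnP exT leT) => d /asboolP[U [dU PU]] maxd.
exists U => v; split; first exact: PU.
move=> Pv; apply: contrapT => /negP vU.
have /maxd : T (\dim (U + <[v]>)%VS).
  apply/asboolP; exists (U + <[v]>)%VS; split=> // x /memv_addP[u uU [w]].
  move=> /vlineP[c ->] ->; apply: subspD => //; first exact: PU.
  exact: subspZ.
rewrite -dU => le; case/negP: vU.
have /eqP eU : U == (U + <[v]>)%VS by rewrite eqEdim addvSl.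
by rewrite memvE eU addvSr.
Qed.

(** [F] embeds [Z] in a finite-dimensional space; a basis of a complement of the image of [B] in the
    image of [Z] lifts to the required family. *)
Lemma qdim_exists (X : lmodType K) (V : vectType K) (F : X -> V)
    (Z B : X -> Prop) : subsp Z -> subsp B -> (forall x, B x -> Z x) ->
  linear F -> (forall x, Z x -> F x = 0 -> x = 0) -> exists d, qdim Z B d.
Proof.
move=> sZ sB BZ linF injF.
pose L := lin_of linF.
have injL x : Z x -> L x = 0 -> x = 0 := injF x.
have im_subsp (P : X -> Prop) :
    subsp P -> subsp (fun v => exists2 x, P x & L x = v).
  move=> [P0 PD]; split; first by exists 0; rewrite ?linear0.
  move=> c _ _ [x Px <-] [y Py <-]; exists (c *: x + y); first exact: PD.
  by rewrite linearP.
have [UZ UZP] := vspace_of_subsp (im_subsp _ sZ).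
have [UB UBP] := vspace_of_subsp (im_subsp _ sB).
have sBZ : (UB <= UZ)%VS.
  by apply/subvP=> v /UBP[x Bx <-]; apply/UZP; exists x => //; apply: BZ.
set W := (UZ :\: UB)%VS; exists (\dim W).
have sumW : (W + UB = UZ)%VS.
  by rewrite /W addv_diff; apply/addv_idPl.
have capW : (W :&: UB = 0)%VS.
  apply/eqP; rewrite -subv0; apply: subv_trans (_ : (UZ :\: UB) :&: UB <= 0)%VS.
    by [].
  by rewrite capv_diff.
have zE (i : 'I_(\dim W)) : exists x, Z x /\ L x = (vbasis W)`_i.
  have /UZP[x Zx xE] : (vbasis W)`_i \in UZ.
    apply: (subvP (diffvSl UZ UB)); apply: vbasis_mem.
    by rewrite mem_nth ?size_tuple.
  by exists x.
have [z zP] := choice zE; exists z; split=> [i|x Zx]; first by case: (zP i).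
have Lsum (c : 'rV[K]_(\dim W)) :
    L (\sum_i c 0 i *: z i) = \sum_i c 0 i *: (vbasis W)`_i.
  rewrite linear_sum; apply: eq_bigr => i _; rewrite linearZ.
  by case: (zP i) => _ ->.
have sumWm (c : 'rV[K]_(\dim W)) : \sum_i c 0 i *: (vbasis W)`_i \in W.
  apply: memv_suml => i _; apply/memvZ/vbasis_mem.
  by rewrite mem_nth ?size_tuple.
have : L x \in (W + UB)%VS by rewrite sumW; apply/UZP; exists x.
case/memv_addP=> w wW [b bB Lx].
exists (\row_i coord (vbasis W) i w).
have cE : \sum_i (\row_i coord (vbasis W) i w) 0 i *: (vbasis W)`_i = w.
  by rewrite [RHS](coord_vbasis wW); apply: eq_bigr => i _; rewrite mxE.
split=> [|c' Bc'].
  have /UBP[y By yb] := bB.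
  suff -> : x - \sum_i (\row_i coord (vbasis W) i w) 0 i *: z i = y by [].
  apply/eqP; rewrite -subr_eq0; apply/eqP/injL.
    apply: subspB; [|apply: subspB|exact: BZ] => //.
    by apply: subsp_sum => // i; case: (zP i).
  by rewrite !linearB Lsum cE yb Lx addrAC addrK subrr.
have /UBP LB : exists2 y, B y & L y = L (x - \sum_i c' 0 i *: z i).
  by exists (x - \sum_i c' 0 i *: z i).
have : L (x - \sum_i c' 0 i *: z i) - b \in UB by rewrite memvB.
rewrite linearB Lsum Lx addrAC addrK => wB.
have : w - \sum_i c' 0 i *: (vbasis W)`_i \in (W :&: UB)%VS.
  by rewrite memv_cap wB memvB.
rewrite capW memv0 subr_eq0 => /eqP ->; apply/rowP=> i; rewrite mxE.
by rewrite coord_sum_free ?(basis_free (vbasisP _)).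
Qed.

End QuotientDimension.

Definition fin_dim (K : fieldType) (X : lmodType K) (r : nat) : Prop :=
  exists (V : vectType K) (f : {linear V -> X}), \dim {:V} = r /\ bijective f.

Section FiniteDimension.
Variable K : fieldType.
Implicit Types (X Y : lmodType K) (V : vectType K).

Lemma bij_of_injsurj (T T' : Type) (f : T -> T') :
  injective f -> (forall y, exists x, f x = y) -> bijective f.
Proof.
by move=> fI /choice[g gP]; exists g => // x; apply: fI; rewrite gP.
Qed.

Lemma inv_linear (R : nzRingType) (M N : lmodType R) (f : {linear M -> N}) g :
  cancel f g -> cancel g f -> linear g.
Proof. by move=> fK gK a x y; apply: (can_inj fK); rewrite linearP !gK. Qed.

Lemma fin_dim_surj V X (p : {linear V -> X}) :
  (forall x, exists v, p v = x) -> exists r, fin_dim X r.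
Proof.
move=> p_surj.
have [|U UP] := @vspace_of_subsp K V (fun v => p v = 0).
  by split=> [|c x y px py]; rewrite ?linear0 // linearP px py scaler0 addr0.
pose q (w : subvs_of (U^C)%VS) := p (vsval w).
have q_lin : linear q by move=> c x y; rewrite /q !linearP.
pose f := lin_of q_lin; eexists; exists _, f; split; first by [].
apply: bij_of_injsurj => [x y fxy|x].
  apply/eqP; rewrite -subr_eq0; apply/eqP/val_inj => /=.
  have : vsval (x - y) \in (U :&: U^C)%VS.
    rewrite memv_cap subvsP andbT; apply/UP.
    by rewrite !linearB -[p (vsval x)]/(f x) fxy subrr.
  by rewrite capv_compl memv0 => /eqP.
have [v <-] := p_surj x.
have /memv_addP[u uU [w wU ->]] : v \in (U + U^C)%VS by rewrite addv_complf memvf.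
exists (vsproj _ w); rewrite -[f _]/(p (vsval _)) vsprojK // linearD.
by have /UP -> := uU; rewrite add0r.
Qed.

Lemma fin_dim_inj V X (f : {linear X -> V}) : injective f ->
  exists U : {vspace V}, (forall v, v \in U <-> exists x, f x = v) /\
    fin_dim X (\dim U).
Proof.
move=> fI; have [|U UP] := @vspace_of_subsp K V (fun v => exists x, f x = v).
  split=> [|c _ _ [x <-] [y <-]]; first by exists 0; rewrite linear0.
  by exists (c *: x + y); rewrite linearP.
exists U; split=> //.
have [g gP] := choice (fun w : subvs_of U => proj1 (UP (vsval w)) (subvsP w)).
have g_lin : linear g by move=> c x y; apply: fI; rewrite linearP !gP linearP.
pose h := lin_of g_lin; exists _, h; split; first by rewrite dimvf.
apply: bij_of_injsurj => [x y hxy|x].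
  by apply: val_inj => /=; rewrite -!gP -[g x]/(h x) hxy.
have fxU : f x \in U by apply/UP; exists x.
by exists (vsproj _ (f x)); apply: fI; rewrite [f (h _)]gP vsprojK.
Qed.

Lemma fin_dim_basis X r : fin_dim X r ->
  exists g : 'I_r -> X, forall x, exists c : 'I_r -> K, x = \sum_i c i *: g i.
Proof.
move=> [V [f [<- [f' fK f'K]]]]; exists (fun i => f (vbasis {:V})`_i) => x.
exists (fun i => coord (vbasis {:V}) i (f' x)).
rewrite -[LHS]f'K [f' x in LHS](coord_vbasis (memvf _)) linear_sum.
by apply: eq_bigr => i _; rewrite linearZ.
Qed.

Lemma fin_dim_section X Y r (p : {linear X -> Y}) : fin_dim Y r ->
  (forall y, exists x, p x = y) ->
  exists s : {linear Y -> X}, forall y, p (s y) = y.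
Proof.
move=> [V [f [_ [f' fK f'K]]]] p_surj.
have [g gP] := choice (fun i : 'I_(\dim {:V}) => p_surj (f (vbasis {:V})`_i)).
pose t y := \sum_i coord (vbasis {:V}) i (f' y) *: g i.
have t_lin : linear t.
  move=> c x y; rewrite /t (inv_linear fK f'K) scaler_sumr -big_split.
  by apply: eq_bigr => i _; rewrite linearP scalerDl scalerA.
exists (lin_of t_lin) => y; rewrite lin_ofE linear_sum -[RHS]f'K.
rewrite [f' y in RHS](coord_vbasis (memvf _)) linear_sum.
by apply: eq_bigr => i _; rewrite !linearZ gP.
Qed.

Lemma injective_endo_surj X r (f : {linear X -> X}) : fin_dim X r ->
  injective f -> forall y, exists x, f x = y.
Proof.
move=> [V [g [_ [g' gK g'K]]]] fI y.
have h_lin : linear (g' \o f \o g).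
  by move=> c u v /=; rewrite !linearP (inv_linear gK g'K).
pose h := lin_of h_lin.
have k0 : lker (linfun h) == 0%VS.
  rewrite -subv0; apply/subvP=> v; rewrite memv_ker memv0 lfunE => /eqP hv.
  have /(congr1 g) : g' (f (g v)) = 0 := hv.
  rewrite g'K linear0 -(linear0 f) => /fI; rewrite -(linear0 g).
  by move=> /(can_inj gK) ->.
have : g' y \in limg (linfun h).
  rewrite (_ : limg _ = fullv) ?memvf //; apply/eqP.
  by rewrite eqEdim subvf -(limg_ker_dim (linfun h) fullv) capfv (eqP k0) dimv0 /=.
case/memv_imgP=> v _; rewrite lfunE => hv; exists (g v).
by apply: (can_inj g'K); rewrite hv.
Qed.

End FiniteDimension.

Import passmx.

(** Since [X] is nonzero, the characteristic polynomial of a matrix of [f] is not constant and has a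
    root in the closed field [K]. *)
Lemma endo_eigenvalue (K : closedFieldType) (X : lmodType K) r
    (f : {linear X -> X}) : fin_dim X r -> (exists x : X, x != 0) ->
  exists (c : K) (x : X), x != 0 /\ f x = c *: x.
Proof.
move=> [V [g [_ [g' gK g'K]]]] [x0 x0n0]; pose e := vbasis {:V}.
have eP : basis_of fullv e by apply: vbasisP.
have h_lin : linear (g' \o f \o g).
  by move=> c u v /=; rewrite !linearP (inv_linear gK g'K).
pose h := lin_of h_lin.
have n_gt0 : \dim {:V} != 0%N.
  apply: contra_neq x0n0 => n0; rewrite -[x0]g'K (_ : g' x0 = 0) ?linear0 //.
  apply/eqP; rewrite -memv0 (_ : 0%VS = fullv) ?memvf //.
  by apply/esym/eqP; rewrite -dimv_eq0 n0.
have [|c c_root] := closed_rootP (char_poly (mxof e e (linfun h))) _.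
  by rewrite size_char_poly eqSS.
have /eigenvalueP[v] : eigenvalue (mxof e e (linfun h)) c.
  by rewrite eigenvalue_root_char.
rewrite mul_mxof lfunE => /(congr1 (vecof e)); rewrite rVofK // linearZ => hv v_n0.
exists c, (g (vecof e v)); split.
  apply: contra_neq v_n0 => gv0; apply/eqP; rewrite -(vecof_eq0 eP); apply/eqP.
  by apply: (can_inj gK); rewrite gv0 linear0.
by apply: (can_inj g'K); rewrite -[LHS]/(h (vecof e v)) hv -[c *: g _]linearZ gK.
Qed.

(** * Modules as vector spaces over the ground field *)

Section ScalarRestriction.
Variables (K : fieldType) (A : falgType K).
Implicit Types M N : lmodType A^c.

(* M as a vector space over K. *)
Definition kmod M : Type := M.

HB.instance Definition _ M := GRing.Zmodule.on (kmod M).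

Definition kscale M (c : K) (m : M) : M := (c%:A : A^c) *: m.

Fact kscaleA M a b (m : M) : kscale a (kscale b m) = kscale (a * b) m.
Proof.
rewrite /kscale scalerA; congr (_ *: _).
by rewrite -[LHS]/((b%:A : A) * a%:A) -scalerAl mul1r scalerA mulrC.
Qed.

Fact kscale1 M : left_id 1 (@kscale M).
Proof. by move=> m; rewrite /kscale !scale1r. Qed.

Fact kscaleDr M : right_distributive (@kscale M) +%R.
Proof. by move=> c m n; rewrite /kscale scalerDr. Qed.

Fact kscaleDl M m : {morph (@kscale M)^~ m : a b / a + b}.
Proof. by move=> a b; rewrite /kscale scalerDl; apply: scalerDl. Qed.

HB.instance Definition _ M := GRing.Zmodule_isLmodule.Build K (kmod M)
  (@kscaleA M) (@kscale1 M) (@kscaleDr M) (@kscaleDl M).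

Lemma kscaleE M c (m : kmod M) : c *: m = kscale c m.
Proof. by []. Qed.

Lemma kscale_comm M (a : A^c) c (m : M) : a *: kscale c m = kscale c (a *: m).
Proof.
rewrite /kscale !scalerA; congr (_ *: _).
by rewrite -[LHS]/((c%:A : A) * (a : A)) -[RHS]/((a : A) * c%:A)
  -scalerAl -scalerAr mul1r mulr1.
Qed.

Lemma kscale_algebra M (a : A) c (m : M) :
  (c *: a : A^c) *: m = kscale c ((a : A^c) *: m).
Proof.
rewrite /kscale scalerA; congr (_ *: _).
by rewrite -[RHS]/((a : A) * c%:A) -scalerAr mulr1.
Qed.

Lemma kscale_algebraP M c (a b : A) (m : M) :
  (c *: a + b : A^c) *: m = kscale c ((a : A^c) *: m) + (b : A^c) *: m.
Proof. by rewrite -kscale_algebra -scalerDl. Qed.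

Definition kfun M N (f : M -> N) : kmod M -> kmod N := f.

Fact kfun_linear M N (f : {linear M -> N}) : linear (kfun f).
Proof. by move=> c x y; rewrite /kfun linearP. Qed.

HB.instance Definition _ M N (f : {linear M -> N}) :=
  GRing.isLinear.Build K (kmod M) (kmod N) _ (kfun f) (kfun_linear f).

(** [A] is finite-dimensional, so a quotient of [A^n] is too; conversely a basis over [K] generates
    over [A]. *)
Lemma fin_dimP M :
  finitely_generated M <-> exists r, fin_dim (kmod M) r.
Proof.
split=> [[n [g gP]]|[r /fin_dim_basis[g gP]]].
  pose p (v : {ffun 'I_n -> A}) : kmod M := \sum_i (v i : A^c) *: g i.
  have p_lin : linear p.
    move=> c u v; rewrite /p scaler_sumr -big_split; apply: eq_bigr => i _.
    by rewrite !ffunE scalerDl kscale_algebra.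
  apply: (fin_dim_surj (p := lin_of p_lin)) => m; have [c ->] := gP m.
  exists [ffun i => c i].
  by apply: eq_bigr => i _; rewrite ffunE.
exists r, g => m; have [c ->] := gP m.
by exists (fun i => (c i)%:A).
Qed.

Lemma fin_dim_fgmod (M : fgmod A) : exists r, fin_dim (kmod M) r.
Proof. exact/fin_dimP/fgmodP. Qed.

End ScalarRestriction.

(** * Ext^1 as derivations modulo inner derivations *)

Section Derivations.
Variables (K : fieldType) (A : falgType K).
Implicit Types M N : lmodType A^c.

(* A derivation phi is the corner of a module structure
   a (n, m) = (a n + phi a m, a m) on N x M, i.e. of an extension of M by N. *)
Definition derivation M N (phi : A -> M -> N) : Prop :=
  [/\ forall c a b m, phi (c *: a + b) m = kscale c (phi a m) + phi b m,
      forall a m m', phi a (m + m') = phi a m + phi a m' &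
      forall (a b : A^c) m, phi (a * b) m = phi a (b *: m) + a *: phi b m].

(** For a derivation [phi] this says that the extension splits: [m |-> (h m, m)] is an [A]-linear
    section. *)
Definition inner_derivation M N (phi : A -> M -> N) : Prop :=
  exists h : {linear kmod M -> kmod N},
    forall (a : A^c) m, phi a m = (h (a *: m) : N) - a *: (h m : N).

Lemma kscale_lin M N (h : {linear kmod M -> kmod N}) c (m m' : M) :
  h (kscale c m + m') = kscale c (h m) + h m' :> N.
Proof. exact: linearP. Qed.

Lemma kadd_lin M N (h : {linear kmod M -> kmod N}) (m m' : M) :
  h (m + m') = h m + h m' :> N.
Proof. exact: linearD. Qed.

Lemma kscaleN M c (m : M) : kscale c (- m) = - kscale c m.
Proof. exact: scalerN. Qed.

Lemma derivation_subsp M N : subsp (@derivation M N : (A -> M -> kmod N) -> Prop).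
Proof.
split=> [|c f g [f1 f2 f3] [g1 g2 g3]].
  have E a m : (0 : A -> M -> kmod N) a m = 0 :> N by [].
  split=> [c a b m|a m m'|a b m]; rewrite !E ?addr0 //.
    exact/esym/scaler0.
  by rewrite scaler0 addr0.
have E a m : (c *: f + g : A -> M -> kmod N) a m = kscale c (f a m) + g a m :> N.
  by [].
split=> [k a b m|a m m'|a b m]; rewrite !E.
- rewrite f1 g1 !kscaleDr !kscaleA mulrC -!addrA; congr (_ + _).
  by rewrite addrCA.
- by rewrite f2 g2 kscaleDr -!addrA; congr (_ + _); rewrite addrCA.
- rewrite f3 g3 scalerDr kscaleDr kscale_comm -!addrA; congr (_ + _).
  by rewrite addrCA.
Qed.

Lemma derivation0l M N (psi : A -> M -> N) m : derivation psi -> psi 0 m = 0.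
Proof.
case=> pl _ _; have := pl (-1) 0 0 m.
by rewrite scaler0 addr0 -[kscale _ _]/((-1) *: _ : kmod _) scaleN1r addNr.
Qed.

Lemma derivation0r M N (psi : A -> M -> N) a : derivation psi -> psi a 0 = 0.
Proof.
case=> _ pD _; apply/eqP; have /eqP := pD a 0 0.
by rewrite addr0 -subr_eq0 opprD addrA subrr sub0r oppr_eq0.
Qed.

Lemma inner_derivation_subsp M N :
  subsp (@inner_derivation M N : (A -> M -> kmod N) -> Prop).
Proof.
split=> [|c f g [h hP] [k kP]].
  pose z : {linear kmod M -> kmod N} := \0.
  have E n : z n = 0 :> N by [].
  by exists z => a m; rewrite !E scaler0 subr0.
pose l : {linear kmod M -> kmod N} := c \*: h \+ k.
have E n : l n = kscale c (h n) + k n :> N by [].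
exists l => a m.
rewrite !E scalerDr kscale_comm opprD -[LHS]/(kscale c (f a m) + g a m) hP kP.
by rewrite kscaleDr kscaleN -!addrA; congr (_ + _); rewrite addrCA.
Qed.

End Derivations.

Section ConnectingCocycle.
Variables (K : fieldType) (A : falgType K) (M N P0 P1 P2 : lmodType A^c).
Variables (e : {linear P0 -> M}) (d1 : {linear P1 -> P0}) (d2 : {linear P2 -> P1}).
Variables (exact1 : exact_at d1 e) (exact2 : exact_at d2 d1).
Variables (s : {linear kmod M -> kmod P0}) (sP : forall m, e (s m) = m).
Variables (r : P0 -> P1) (rP : forall y, e y = 0 -> d1 (r y) = y).

(* f : P1 -> N vanishing on im d2 is viewed as a map on ker e = im d1, by means
   of the set-theoretic section r; the class of the extension it defines
   measures the failure of the K-linear section s to be A-linear. *)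
Definition connecting (f : P1 -> N) (a : A) (m : M) : N :=
  f (r ((a : A^c) *: (s m : P0) - s ((a : A^c) *: m))).

Definition cocycle (f : P1 -> N) : Prop := linear f /\ forall x, f (d2 x) = 0.

(** [r y] and [x] differ by an element of [ker d1 = im d2], where [f] vanishes; hence [f \o r] on
    [ker e] does not depend on the choice of [r]. *)
Lemma cocycle_factor f x y : cocycle f -> d1 x = y -> f (r y) = f x.
Proof.
move=> [fl f0] xy; have ey : e y = 0 by apply/exact1; exists x.
have /exact2[p pE] : d1 (r y - x) = 0 by rewrite linearB xy rP // subrr.
apply/eqP; rewrite -subr_eq0 -[f _](lin_ofE fl) -[f x](lin_ofE fl) -linearB.
by rewrite -pE; apply/eqP/f0.
Qed.

Lemma cocycle_factorP f a y y' : cocycle f -> e y = 0 -> e y' = 0 ->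
  f (r (a *: y + y')) = a *: f (r y) + f (r y').
Proof.
move=> fc ey ey'; rewrite (@cocycle_factor _ (a *: r y + r y')) //.
  by case: fc => fl _; exact: fl.
by rewrite linearP !rP.
Qed.

Lemma section_defect_ker (a : A^c) (m : M) : e (a *: (s m : P0) - s (a *: m)) = 0.
Proof. by rewrite linearB linearZ !sP subrr. Qed.

(** The product rule is the telescoping [a b s(m) - s(a b m) = a (b s(m) - s(b m)) + (a s(b m) - s(a
    b m))] in [ker e], where [f \o r] is [A]-linear. *)
Lemma connecting_derivation f : cocycle f -> derivation (connecting f).
Proof.
move=> fc; split=> [c a b m|a m m'|a b m]; rewrite /connecting.
- rewrite -(cocycle_factorP _ fc) ?section_defect_ker //; congr (f (r _)).
  rewrite (kscale_algebraP c a b m) kscale_lin scalerDl kscale_algebra opprD.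
  by rewrite -[X in _ = X + _]/(kscale c _) kscaleDr kscaleN addrACA.
- have := cocycle_factorP 1 fc (section_defect_ker a m) (section_defect_ker a m').
  rewrite !scale1r => <-; congr (f (r _)).
  by rewrite scalerDr !(kadd_lin s) scalerDr opprD addrACA.
- rewrite [RHS]addrC -(cocycle_factorP _ fc) ?section_defect_ker //.
  by congr (f (r _)); rewrite scalerBr !scalerA addrA subrK.
Qed.

(** On [ker e] the map [f \o r] is [h], so [connecting] takes the value [a h(s m) - h(s(a m))]: it
    is inner through [- h \o s]. *)
Lemma connecting_coboundary (h : {linear P0 -> N}) (f : P1 -> N) :
  (forall x, f x = h (d1 x)) -> inner_derivation (connecting f).
Proof.
pose l : {linear kmod M -> kmod N} := \- (kfun h \o s).
have E n : l n = - h (s n) :> N by [].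
move=> fh; exists l => a m; rewrite !E /connecting fh rP; last first.
  exact: section_defect_ker.
by rewrite linearB linearZ scalerN opprK addrC.
Qed.

Lemma inner_connecting f : cocycle f -> inner_derivation (connecting f) ->
  exists h : {linear P0 -> N}, forall x, f x = h (d1 x).
Proof.
move=> fc [h hP].
have ker p : e (p - s (e p)) = 0 by rewrite linearB sP subrr.
(* Extend [f \o r] from [ker e] to [P0] along the [K]-linear projection [p - s (e p)]. This fails to
   be [A]-linear by exactly the connecting derivation, which subtracting [h (e p)] corrects. *)
pose H p : N := f (r (p - s (e p))) - h (e p).
have HA : linear H.
  move=> a p q; rewrite /H linearP (kadd_lin s) (kadd_lin h).
  have -> : a *: p + q - ((s (a *: e p) : P0) + s (e q)) =
      1 *: (a *: (p - s (e p)) + (q - s (e q))) +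
      (a *: (s (e p) : P0) - s (a *: e p)).
    rewrite scale1r scalerBr [RHS]addrAC; set w := (s (a *: e p) : P0).
    by rewrite [X in _ = X + _]addrA subrK opprD addrACA.
  rewrite (cocycle_factorP _ fc) ?section_defect_ker ?scale1r //;
    last by rewrite linearP !ker scaler0 addr0.
  rewrite (cocycle_factorP _ fc) ?ker //.
  rewrite -[f (r (a *: _ - _))]/(connecting f a (e p)) hP.
  rewrite -addrA opprD scalerBr; set w := (h (a *: e p) : N).
  by rewrite [w - _ + _]addrACA subrr add0r addrACA.
exists (lin_of HA) => x; rewrite lin_ofE /H.
have ed : e (d1 x) = 0 by apply/exact1; exists x.
rewrite ed (linear0 h) (linear0 s) !subr0.
by rewrite (cocycle_factor fc (erefl _)).
Qed.

End ConnectingCocycle.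

Section TwistedModule.
Variables (K : fieldType) (A : falgType K) (M N : lmodType A^c).
Variables (psi : A -> M -> N) (psiP : derivation psi).

(* The argument only serves to attach the module structure to psi. *)
Definition twisted (_ : derivation psi) : Type := (N * M)%type.

HB.instance Definition _ := GRing.Zmodule.on (twisted psiP).

Definition twisted_scale (a : A^c) (x : twisted psiP) : twisted psiP :=
  (a *: x.1 + psi a x.2, a *: x.2).

Lemma derivationD (a b : A^c) m : psi (a + b) m = psi a m + psi b m.
Proof. by case: psiP => /(_ 1 a b m) + _ _; rewrite scale1r kscale1. Qed.

Lemma derivation1 m : psi 1 m = 0.
Proof.
case: psiP => _ _ /(_ 1 1 m); rewrite mulr1 !scale1r => /eqP.
by rewrite -subr_eq0 opprD addNKr oppr_eq0 => /eqP.
Qed.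

Fact twisted_scalerA a b x :
  twisted_scale a (twisted_scale b x) = twisted_scale (a * b) x.
Proof.
have [_ _ pM] := psiP; rewrite /twisted_scale /= pM scalerDr !scalerA.
by congr (_, _); rewrite -!addrA; congr (_ + _); rewrite addrC.
Qed.

Fact twisted_scale1r : left_id 1 twisted_scale.
Proof. by case=> n m; rewrite /twisted_scale /= derivation1 addr0 !scale1r. Qed.

Fact twisted_scalerDr : right_distributive twisted_scale +%R.
Proof.
have [_ pD _] := psiP => a [n m] [n' m']; rewrite /twisted_scale /= pD !scalerDr.
by congr (_, _); rewrite addrACA.
Qed.

Fact twisted_scalerDl x : {morph twisted_scale^~ x : a b / a + b}.
Proof.
move=> a b; rewrite /twisted_scale /= derivationD !scalerDl.
by congr (_, _); rewrite addrACA.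
Qed.

HB.instance Definition _ := GRing.Zmodule_isLmodule.Build A^c (twisted psiP)
  twisted_scalerA twisted_scale1r twisted_scalerDr twisted_scalerDl.

Fact twisted_snd_linear : linear (fun x : twisted psiP => x.2 : M).
Proof. by []. Qed.

End TwistedModule.

(** The second projection from the extension [N x M] twisted by [psi] is onto, so [e] lifts to it;
    the first component of the lift is [l]. The equation says that [psi] becomes inner when pulled
    back to [P]. *)
Lemma projective_derivation (K : fieldType) (A : falgType K)
    (M N P : lmodType A^c) (e : {linear P -> M}) (psi : A -> M -> N) :
  projective P -> derivation psi ->
  exists l : {linear kmod P -> kmod N},
    forall (a : A^c) p, l (a *: p) = a *: (l p : N) + psi a (e p) :> N.
Proof.
move=> P_proj psiP.
have [y|h hP] := P_proj _ _ (lin_of (@twisted_snd_linear _ _ _ _ _ psiP)) e.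
  by exists (0, y).
have hZ a p : (h (a *: p)).1 = a *: (h p).1 + psi a (e p).
  by rewrite linearZ /= -hP.
have l_lin : linear (fun p : kmod P => (h p).1 : kmod N).
  move=> c x y; rewrite (linearD h) /= [(h (c *: x)).1]hZ.
  suff -> : psi c%:A (e x) = 0 by rewrite addr0.
  case: (psiP) => pl _ _; have := pl c 1 0 (e x); rewrite addr0 derivation1 //.
  by rewrite (derivation0l _ psiP) addr0 /kscale scaler0.
by exists (lin_of l_lin) => a p; exact: hZ.
Qed.

Section Resolutions.
Variables (K : fieldType) (A : falgType K).
Implicit Types M N : lmodType A^c.

Lemma free_finitely_generated n : finitely_generated ('rV[A^c]_n).
Proof.
by exists n, (fun i => delta_mx 0 i) => v; exists (v 0); exact: row_sum_delta.
Qed.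

Definition free_module n : fgmod A := FGMod (free_finitely_generated n).

Lemma row_comb_linear M n (x : 'I_n -> M) :
  linear (fun v : 'rV[A^c]_n => \sum_i v 0 i *: x i).
Proof.
move=> a u v; rewrite scaler_sumr -big_split; apply: eq_bigr => i _.
by rewrite !mxE scalerDl scalerA.
Qed.

Lemma free_projective n : projective ('rV[A^c]_n).
Proof.
move=> M N g f g_surj.
have [x xP] := choice (fun i : 'I_n => g_surj (f (delta_mx 0 i))).
exists (lin_of (row_comb_linear x)) => v; rewrite [in RHS](row_sum_delta v).
by rewrite !linear_sum; apply: eq_bigr => i _; rewrite !linearZ xP.
Qed.

(** A [K]-basis of [ker f], finite because [M] is finite-dimensional, generates it over [A]. *)
Lemma kernel_cover M N (f : {linear M -> N}) : finitely_generated M ->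
  exists n (p : {linear 'rV[A^c]_n -> M}), exact_at p f.
Proof.
move=> /fin_dimP[r [V [g [_ [g' gK g'K]]]]].
have [|U UP] := @vspace_of_subsp K V (fun v => f (g v) = 0).
  split=> [|c u v fu fv]; first by rewrite linear0; apply: (linear0 f).
  rewrite linearP; apply: etrans (linearP f c%:A _ _) _.
  by rewrite fu fv scaler0 addr0.
exists (\dim U), (lin_of (row_comb_linear (fun i => g (vbasis U)`_i : M))) => y.
split=> [fy0|[v <-]]; last rewrite lin_ofE.
  have yU : g' y \in U by apply/UP; rewrite g'K.
  exists (\row_i (coord (vbasis U) i (g' y))%:A); rewrite lin_ofE.
  rewrite -[RHS]g'K [g' y in RHS](coord_vbasis yU) linear_sum.
  by apply: eq_bigr => i _; rewrite mxE linearZ.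
rewrite linear_sum big1 // => i _; rewrite linearZ /=.
suff -> : f (g (vbasis U)`_i) = 0 by rewrite scaler0.
by apply/UP/vbasis_mem; rewrite mem_nth ?size_tuple.
Qed.

Definition coboundary M N (P : lmodType A^c) (d1 : {linear M -> P})
    (f : M -> N) : Prop :=
  exists h : {linear P -> N}, forall x, f x = h (d1 x).

Lemma cocycle_subsp N (P1 P2 : lmodType A^c) (d2 : {linear P2 -> P1}) :
  subsp (cocycle d2 : (P1 -> kmod N) -> Prop).
Proof.
split=> [|c f g [fl f0] [gl g0]].
  by split=> // a x y; apply/esym/(etrans (addr0 _))/(@scaler0 _ N).
have E x : (c *: f + g : P1 -> kmod N) x = kscale c (f x) + g x :> N by [].
split=> [a x y|x]; rewrite !E; last by rewrite f0 g0 /kscale scaler0 addr0.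
by rewrite fl gl kscaleDr -kscale_comm scalerDr addrACA.
Qed.

Lemma coboundary_subsp N (P0 P1 : lmodType A^c) (d1 : {linear P1 -> P0}) :
  subsp (coboundary d1 : (P1 -> kmod N) -> Prop).
Proof.
split=> [|c f g [h hP] [k kP]]; first by exists \0.
have l_lin : linear (fun x => kscale c (h x) + k x : N).
  move=> a x y; rewrite !linearP kscaleDr -kscale_comm scalerDr addrACA.
  by [].
by exists (lin_of l_lin) => x; rewrite lin_ofE -hP -kP.
Qed.

Lemma cohomology1_qdim (P0 P1 P2 N : lmodType A^c)
    (d1 : {linear P1 -> P0}) (d2 : {linear P2 -> P1}) d :
  cohomology1_dim N d1 d2 d <->
  qdim (cocycle d2 : (P1 -> kmod N) -> Prop) (coboundary d1) d.
Proof.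
have sE (z : 'I_d -> P1 -> kmod N) (c : 'rV[K]_d) f (h : {linear P0 -> N}) :
  (forall x, f x = \sum_i ((c 0 i)%:A : A^c) *: (z i x : N) + h (d1 x)) <->
  (forall x, (f - \sum_i c 0 i *: z i) x = h (d1 x)).
  have E x : (f - \sum_i c 0 i *: z i) x =
      (f x : N) - \sum_i ((c 0 i)%:A : A^c) *: (z i x : N).
    by rewrite fct_sumE.
  split=> H x; first by rewrite E H addrAC subrr add0r.
  by rewrite -H E addrC subrK.
split=> [[z [z0 zP]]|[z [Zz zP]]].
  exists (fun i => z i : P1 -> kmod N); split=> [i|f [fl f0]].
    by split=> [a x y|x]; [exact: linearP | exact: z0].
  have [c [[h hP] cU]] := zP (lin_of fl) f0.
  exists c; split=> [|c' [k kP]]; first by exists h; apply/sE.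
  by apply: cU; exists k; apply/sE.
exists (fun i => lin_of (proj1 (Zz i))); split=> [i x|f f0].
  by rewrite lin_ofE; case: (Zz i) => _ ->.
have [|c [[h hP] cU]] := zP f; first by split=> // a x y; exact: linearP.
exists c; split=> [|c' [k kP]]; first by exists h; apply/sE.
by apply: cU; exists k; apply/sE.
Qed.

(** [connecting] induces the isomorphism from cohomology classes to derivations modulo inner ones.
    For surjectivity, [psi] pulled back to [P0] is [l(a p) - a l(p)]; then [l \o d1] is a cocycle,
    and its connecting derivation differs from [psi] by the inner derivation of [l \o s]. *)
Lemma has_ext1_qdim M N d : finitely_generated M -> has_ext1_dim M N d ->
  qdim (@derivation K A M N : (A -> M -> kmod N) -> Prop)
    (@inner_derivation K A M N) d.
Proof.
move=> /fin_dimP[r Mfd] [P0 [P1 [P2 [e [d1 [d2]]]]]].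
case=> -[P0_proj _ _] e_surj ex1 ex2 /cohomology1_qdim.
have [s sP] := fin_dim_section (p := kfun e) Mfd e_surj.
have pre (y : P0) : exists x : P1, e y = 0 -> d1 x = y.
  have [/ex1[x xy]|ey0] := EM (e y = 0); first by exists x.
  by exists 0.
have [q qP] := choice pre.
have Phi_lin : linear (connecting s q :
  (P1 -> kmod N) -> (A -> M -> kmod N)) by [].
apply: (qdim_transfer (Phi := lin_of Phi_lin)) => [||f fc|psi psiP|f fc].
- exact: cocycle_subsp.
- exact: inner_derivation_subsp.
- exact: (connecting_derivation (e := e) ex1 ex2 sP qP fc).
- have [l lP] := projective_derivation e P0_proj psiP.
  have ed x : e (d1 x) = 0 by apply/ex1; exists x.
  exists (fun x => l (d1 x)).
    split=> [a x y|x]; last first.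
      by rewrite (_ : d1 (d2 x) = 0) ?(linear0 l) //; apply/ex2; exists x.
    rewrite linearP (kadd_lin l) lP ed.
    by rewrite (derivation0r _ psiP) addr0.
  exists (l \o s) => a m.
  rewrite -[LHS]/(psi a m - connecting s q (fun x => l (d1 x)) a m).
  rewrite /connecting qP; last exact: (section_defect_ker sP).
  rewrite linearB lP [e (s m)]sP opprB addrCA; congr (_ + _).
  by rewrite opprD addrCA subrr addr0.
- split=> [[h hP]|]; first exact: (connecting_coboundary sP qP hP).
  exact: (inner_connecting ex1 ex2 sP qP fc).
Qed.

(** Three covers by free modules begin a resolution. A cochain on the free module of rank [n1] is
    determined by its values on the standard basis, which makes the cohomology
    finite-dimensional. *)
Lemma has_ext1_exists M N : finitely_generated M -> finitely_generated N ->
  exists d, has_ext1_dim M N d.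
Proof.
move=> Mfg /fin_dimP[r [V [g [_ [g' gK g'K]]]]].
(* The kernel of the zero map is [M] itself, so [e] is onto. *)
have [n0 [e eP]] := kernel_cover (\0 : {linear M -> M}) Mfg.
have [n1 [d1 d1P]] := kernel_cover e (free_finitely_generated n0).
have [n2 [d2 d2P]] := kernel_cover d1 (free_finitely_generated n1).
suff [d dP] : exists d, cohomology1_dim N d1 d2 d.
  exists d, (free_module n0), (free_module n1), (free_module n2), e, d1, d2.
  split=> //; first by split; exact: free_projective.
  by move=> y; apply/eP.
pose F (f : 'rV[A^c]_n1 -> kmod N) := [ffun i => g' (f (delta_mx 0 i))].
have F_lin : linear F.
  by move=> c f h; apply/ffunP=> i; rewrite !ffunE (inv_linear gK g'K).
have [f|f [fl _] Ff0|d dP] := qdim_exists (cocycle_subsp N d2)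
  (coboundary_subsp N d1) _ F_lin.
- move=> [h hP]; split=> [a x y|x]; rewrite !hP; first by rewrite !linearP.
  by rewrite (_ : d1 _ = 0) ?linear0 //; apply/d2P; exists x.
- apply/funext => v; rewrite (row_sum_delta v) -[f _](lin_ofE fl) linear_sum.
  rewrite big1 // => i _; rewrite linearZ /=.
  have /ffunP/(_ i) := Ff0; rewrite !ffunE => /(congr1 g).
  by rewrite g'K linear0 => ->; rewrite (@scaler0 _ N).
- by exists d; apply/cohomology1_qdim.
Qed.

End Resolutions.

(** * Adjoining central nilpotent variables *)

Section Restriction.
Variables (K : fieldType) (A B : falgType K) (f : {lrmorphism B -> A}).

(* The first argument only serves to attach the module structure to f. *)
Definition restr (_ : {lrmorphism B -> A}) (M : lmodType A^c) : Type := M.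

HB.instance Definition _ M := GRing.Zmodule.on (restr f M).

Definition restr_scale (M : lmodType A^c) (b : B^c) (m : restr f M) : restr f M :=
  (f b : A^c) *: (m : M).

Section RestrictedModule.
Variable M : lmodType A^c.

Fact restr_scalerA a b (m : restr f M) :
  restr_scale a (restr_scale b m) = restr_scale (a * b) m.
Proof.
rewrite /restr_scale scalerA; congr (_ *: _).
by apply/esym; rewrite -[LHS]/(f ((b : B) * a)) rmorphM.
Qed.

Fact restr_scale1r : left_id 1 (@restr_scale M).
Proof.
by move=> m; rewrite /restr_scale -[1]/(1 : B) rmorph1; apply: scale1r.
Qed.

Fact restr_scalerDr : right_distributive (@restr_scale M) +%R.
Proof. by move=> a m n; exact: scalerDr. Qed.

Fact restr_scalerDl m : {morph (@restr_scale M)^~ m : a b / a + b}.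
Proof.
move=> a b; rewrite /restr_scale -[a + b]/((a : B) + b) rmorphD.
exact: scalerDl.
Qed.

HB.instance Definition _ := GRing.Zmodule_isLmodule.Build B^c (restr f M)
  restr_scalerA restr_scale1r restr_scalerDr restr_scalerDl.

Lemma restrE (b : B^c) (m : restr f M) :
  b *: m = (f b : A^c) *: (m : M) :> M.
Proof. by []. Qed.

Lemma restr_kscale c (m : M) : kscale c (m : restr f M) = kscale c m :> M.
Proof. by rewrite /kscale restrE linearZ /= rmorph1. Qed.

Lemma restr_finitely_generated : finitely_generated M ->
  finitely_generated (restr f M).
Proof.
move=> /fin_dimP[r [V [g [rV [g' gK g'K]]]]]; apply/fin_dimP.
have g_lin : linear (g : V -> kmod (restr f M)).
  by move=> c x y; rewrite kscaleE restr_kscale; exact: linearP.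
by exists r, V, (lin_of g_lin); split=> //; exists g'.
Qed.

End RestrictedModule.

Lemma restr_linear (M N : lmodType A^c) (g : {linear M -> N}) :
  linear (g : restr f M -> restr f N).
Proof. by move=> b m n; rewrite restrE; exact: linearP. Qed.

(** Restriction along a surjection is full; [s] is any set-theoretic section. *)
Lemma linear_restr (M N : lmodType A^c) (s : A -> B)
    (g : {linear restr f M -> restr f N}) :
  cancel s f -> linear (g : M -> N).
Proof.
move=> sK a m n; rewrite -[a in LHS]sK -[a in RHS]sK.
exact: (linearP g (s a : B^c)).
Qed.

Definition restr_fgmod (M : fgmod A) : fgmod B :=
  FGMod (restr_finitely_generated (fgmodP M)).

End Restriction.

(* The model case is A' = A[x_1, ..., x_n]/(x_1^2, ..., x_n^2), or any other
   nilpotent quotient in which x_1, ..., x_n stay independent modulo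
   (x_1, ..., x_n)^2; dpart i is the coefficient of x_i. *)
Record thickening (K : fieldType) (A A' : falgType K) (n : nat) := Thickening {
  inc : {lrmorphism A -> A'};
  red : {lrmorphism A' -> A};
  eps : 'I_n -> A';
  dpart : 'I_n -> {linear A' -> A};
  incK : cancel inc red;
  epsC : forall i b, eps i * b = b * eps i;
  eps_nilpotent : forall i, exists k, eps i ^+ k = 0;
  red_eps : forall i, red (eps i) = 0;
  thickeningE : forall b, exists c : 'I_n -> A',
    b = inc (red b) + \sum_i eps i * c i;
  dpartM : forall i b c, dpart i (b * c) = dpart i b * red c + red b * dpart i c;
  dpart_eps : forall i j, dpart i (eps j) = (i == j)%:R;
  dpart_inc : forall i a, dpart i (inc a) = 0 }.

Section ThickenedDerivations.
Variables (K : fieldType) (A A' : falgType K) (n : nat).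
Variable T : thickening A A' n.
Variables M N : lmodType A^c.

Local Notation M' := (restr (red T) M).
Local Notation N' := (restr (red T) N).

Section Properties.
Variables (phi : A' -> M -> N) (phiP : @derivation K A' M' N' phi).

Let phi0r a : phi a 0 = 0. Proof. exact: derivation0r phiP. Qed.

Let phi0l m : phi 0 m = 0. Proof. exact: (@derivation0l _ A' M' N' phi m phiP). Qed.

Lemma derivation_inc : derivation (fun a => phi (inc T a)).
Proof.
have [pl pD pM] := phiP; split=> [c a b m|a m m'|a b m].
- by rewrite linearP pl -(restr_kscale (red T)).
- exact: pD.
- have -> : inc T (a * b) = (inc T a : A'^c) * inc T b by exact: rmorphM.
  by rewrite pM !restrE !incK.
Qed.

(** Expand [phi] at the product of [eps T i] and [inc T a] in both orders. As [eps T i] acts by zero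
    on both modules, one term survives on each side. *)
Lemma derivation_eps i : linear (phi (eps T i)).
Proof.
have [pl pD pM] := phiP => a m m'; rewrite pD; congr (_ + _).
have := pM (inc T a) (eps T i) m; have := pM (eps T i) (inc T a) m.
have -> : (inc T a : A'^c) * eps T i = (eps T i : A'^c) * inc T a by exact: epsC.
move=> ->; rewrite !restrE incK red_eps !scale0r phi0r addr0 add0r.
by move=> ->.
Qed.

(** In [b = inc T (red T b) + \sum_i eps T i * c i] one has [red T (c i) = dpart T i b], and as the
    variables act by zero the product rule leaves only the values at [eps T i]. So a derivation is
    determined by its restriction to [A] and its values at the variables. *)
Lemma derivation_decomp b m : phi b m =
  phi (inc T (red T b)) m + \sum_i phi (eps T i) ((dpart T i b : A^c) *: m).
Proof.
have [pl pD pM] := phiP; have [c bE] := thickeningE T b.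
have dE i : dpart T i b = red T (c i).
  rewrite {1}bE linearD dpart_inc add0r linear_sum (bigD1 i) //= big1.
    by rewrite dpartM dpart_eps eqxx mul1r red_eps mul0r !addr0.
  move=> j ji; rewrite dpartM dpart_eps eq_sym (negPf ji) red_eps.
  by rewrite !mul0r addr0.
have padd (x y : A') : phi (x + y) m = phi x m + phi y m.
  by have := pl 1 x y m; rewrite scale1r kscale1.
rewrite {1}bE padd; congr (_ + _).
rewrite (big_morph (phi^~ m) padd (phi0l m)).
apply: eq_bigr => i _; rewrite dE.
have -> : eps T i * c i = (c i : A'^c) * eps T i by [].
rewrite pM !restrE red_eps scale0r phi0r add0r.
have := derivation_eps i (red T (c i) : A^c) m 0.
by rewrite !addr0 phi0r addr0.
Qed.

Lemma inner_restr : @inner_derivation K A' M' N' phi <->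
  inner_derivation (fun a => phi (inc T a)) /\ forall i m, phi (eps T i) m = 0.
Proof.
split=> [[h hP]|[[h hP] p0]].
  have h_lin : linear (h : kmod M -> kmod N).
    move=> c x y; rewrite -[c *: x]/(kscale c (x : M)).
    rewrite -(restr_kscale (red T)) -[RHS]/(kscale c (h x : N) + h y).
    by rewrite -(restr_kscale (red T)); exact: (linearP h).
  split=> [|i m]; first by exists (lin_of h_lin) => a m; rewrite hP !restrE incK.
  by rewrite hP !restrE red_eps !scale0r subr0; exact: (linear0 h).
have h_lin : linear (h : kmod M' -> kmod N').
  move=> c x y; rewrite kscaleE [kscale c x](restr_kscale (red T)).
  rewrite [c *: _](restr_kscale (red T)); exact: (linearP h).
exists (lin_of h_lin) => b m; rewrite derivation_decomp hP.
by rewrite big1 ?addr0 // => i _; rewrite p0.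
Qed.

End Properties.

(** Converse of the decomposition: by the Leibniz rule [dpartM], the values at the variables can be
    prescribed as arbitrary [A]-linear maps [theta i]. *)
Lemma thicken_derivation (psi : A -> M -> N) (theta : 'I_n -> {linear M -> N}) :
  derivation psi -> @derivation K A' M' N' (fun b m =>
    psi (red T b) m + \sum_i theta i ((dpart T i b : A^c) *: m)).
Proof.
move=> [pl pD pM]; split=> [c a b m|a m m'|a b m].
- rewrite linearP pl restr_kscale kscaleDr addrACA; congr (_ + _).
  rewrite -[kscale c (\sum__ _)]/(c *: (_ : kmod N)) scaler_sumr -big_split.
  apply: eq_bigr => i _; rewrite linearP /=.
  rewrite (kscale_algebraP c _ _ (m : M)) linearD; congr (_ + _).
  exact: (linearZ_LR (theta i) c%:A).
- rewrite pD addrACA -big_split; congr (_ + _).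
  by apply: eq_bigr => i _; rewrite scalerDr linearD.
- have -> : red T (a * b) = (red T a : A^c) * red T b by exact: rmorphM.
  rewrite pM !restrE scalerDr addrACA scaler_sumr -big_split; congr (_ + _).
  apply: eq_bigr => i _; rewrite -(linearZ_LR (theta i)).
  rewrite /= -(linearD (theta i)) !scalerA -scalerDl.
  by congr (theta i (_ *: _)); exact: etrans (dpartM _ _ _ _) (addrC _ _).
Qed.

Local Notation Der := (@derivation K A M N : (A -> M -> kmod N) -> Prop).
Local Notation Inn := (@inner_derivation K A M N).
Local Notation Der' := (@derivation K A' M' N' : (A' -> M' -> kmod N') -> Prop).
Local Notation Inn' := (@inner_derivation K A' M' N').

Lemma inflate_derivation (psi : A -> M -> N) : derivation psi ->
  @derivation K A' M' N' (fun b m => psi (red T b) m).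
Proof.
move=> /(thicken_derivation (fun=> \0)); congr derivation.
by apply/funext=> b; apply/funext=> m; rewrite big1 ?addr0.
Qed.

(** The value of a derivation at a variable is an [A]-linear map [M -> N], hence zero; so inflation
    along [red T] is an isomorphism on classes. *)
Lemma qdim_thicken0 d : (forall (g : {linear M -> N}) m, g m = 0) ->
  qdim Der Inn d -> qdim Der' Inn' d.
Proof.
move=> hom0.
have Phi_lin : linear (fun (psi : A -> M -> kmod N) =>
    (fun b m => psi (red T b) m) : A' -> M' -> kmod N').
  move=> c f g; apply/funext=> b; apply/funext=> m.
  rewrite -[LHS]/(kscale c (f (red T b) m : N) + g (red T b) m).
  by rewrite -(restr_kscale (red T)).
have eps0 phi : @derivation K A' M' N' phi -> forall i m, phi (eps T i) m = 0.
  by move=> phiP i m; exact: (hom0 (lin_of (derivation_eps phiP i))).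
apply: (qdim_transfer (Phi := lin_of Phi_lin)) => [||psi|phi phiP|psi psiP].
- exact: derivation_subsp.
- exact: inner_derivation_subsp.
- exact: inflate_derivation.
- exists (fun a => phi (inc T a)); first exact: derivation_inc.
  rewrite (_ : phi - _ = 0); first by case: (inner_derivation_subsp M' N').
  apply/eqP; rewrite subr_eq0; apply/eqP/funext=> b; apply/funext=> m.
  rewrite [LHS](derivation_decomp phiP) big1 ?addr0 // => i _.
  exact: eps0.
- have psi'P := inflate_derivation psiP; rewrite lin_ofE.
  have E : (fun a => psi (red T (inc T a))) = psi by apply/funext=> a; rewrite incK.
  split=> [psi_in|/(inner_restr psi'P)[+ _]]; last by rewrite E.
  by apply/(inner_restr psi'P); split; [rewrite E | exact: (eps0 _ psi'P)].
Qed.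

(** Here [g] spans the [A]-linear maps [M -> N]. To the inflations of a basis one adds, for each
    variable, the derivation [w k] with value [g] at that variable and 0 at the others. *)
Lemma qdim_thicken1 d (g : {linear M -> N}) : (exists m, g m != 0) ->
  (forall h : {linear M -> N}, exists c, forall m, h m = kscale c (g m)) ->
  qdim Der Inn d -> qdim Der' Inn' (d + n).
Proof.
move=> [m0 gm0] homE [z [Zz zP]].
pose w k (b : A') (m : M) : N := g ((dpart T k b : A^c) *: m).
have wP k : @derivation K A' M' N' (w k).
  have := @thicken_derivation (fun _ _ => 0) (fun i => if i == k then g else \0).
  have /[swap]/[apply] : derivation (fun (_ : A) (_ : M) => 0 : N).
    by case: (derivation_subsp M N).
  congr derivation; apply/funext=> b; apply/funext=> m.
  rewrite add0r (bigD1 k) //= eqxx big1 ?addr0 // => i /negPf ik.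
  by rewrite ik.
pose z' (k : 'I_(d + n)) : A' -> M' -> kmod N' :=
  match fintype.split k with inl i => fun b m => z i (red T b) m | inr k => w k end.
have z'P k : Der' (z' k).
  rewrite /z'; case: (fintype.split k) => [i|j]; last exact: wP.
  exact: inflate_derivation.
have z'l i : z' (lshift n i) = fun b m => z i (red T b) m.
  by rewrite /z' (unsplitK (inl i)).
have z'r k : z' (rshift d k) = w k by rewrite /z' (unsplitK (inr k)).
pose comb (c : 'rV[K]_(d + n)) : A' -> M' -> kmod N' := \sum_k c 0 k *: z' k.
have combE c b m : comb c b m =
    (\sum_i lsubmx c 0 i *: (z i (red T b) m : kmod N)) +
    \sum_k rsubmx c 0 k *: (w k b m : kmod N).
  rewrite /comb !fct_sumE big_split_ord; congr (_ + _); apply: eq_bigr => k _.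
    by rewrite z'l mxE -[LHS]/(kscale _ (_ : N')) restr_kscale.
  by rewrite z'r mxE -[LHS]/(kscale _ (_ : N')) restr_kscale.
exists z'; split=> // phi phiP.
have subP c : @derivation K A' M' N' (phi - comb c).
  by apply: (subspB (derivation_subsp M' N')) => //; apply: subsp_sum => //;
    exact: derivation_subsp.
have [t tP] := choice (fun k => homE (lin_of (derivation_eps phiP k))).
(* The two blocks of coordinates separate: the [w k] vanish on [A], and inflations vanish at the
   variables, where [phi] takes the values [t k] times [g]. *)
have innP (c : 'rV[K]_(d + n)) : Inn' (phi - comb c) <->
    Inn ((fun a => phi (inc T a)) - \sum_i lsubmx c 0 i *: (z i : A -> M -> kmod N))
    /\ rsubmx c = \row_k t k.
  have E1 : (fun a => (phi - comb c) (inc T a)) =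
      (fun a => phi (inc T a)) - \sum_i lsubmx c 0 i *: (z i : A -> M -> kmod N).
    apply/funext=> a; apply/funext=> m.
    rewrite -[LHS]/((phi (inc T a) m : N) - comb c (inc T a) m) combE incK.
    rewrite [X in _ - (_ + X)]big1 ?addr0 => [|k _]; last first.
      by rewrite /w dpart_inc scale0r linear0 scaler0.
    by rewrite !fctE !fct_sumE.
  have E2 i m : (phi - comb c) (eps T i) m =
      kscale (t i - rsubmx c 0 i) (g m) :> N.
    rewrite -[LHS]/((phi (eps T i) m : N) - comb c (eps T i) m) combE.
    rewrite big1 ?add0r => [|k _]; last first.
      by rewrite red_eps (derivation0l _ (Zz k)) scaler0.
    rewrite (bigD1 i) //= big1 ?addr0 => [|k /negPf ki]; last first.
      by rewrite /w dpart_eps ki scale0r linear0 scaler0.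
    rewrite /w dpart_eps eqxx scale1r -[phi _ m]/(lin_of (derivation_eps phiP i) m).
    by rewrite tP -[RHS]/((_ - _) *: (g m : kmod N)) scalerBl.
  have in_der := inner_restr (subP c); split.
    move/in_der => [in1 eps0]; split; first by rewrite -E1.
    apply/rowP=> i; rewrite [RHS]mxE; apply/esym/eqP; rewrite -subr_eq0.
    have /eqP : (t i - rsubmx c 0 i) *: (g m0 : kmod N) = 0.
      by rewrite -[LHS]/(kscale _ (g m0)) -E2; exact: eps0.
    by rewrite scaler_eq0 => /orP[//|/eqP g0]; case/eqP: gm0; exact: g0.
  move=> [in1 rc]; apply/in_der; split; first by rewrite E1.
  by move=> i m; rewrite E2 rc mxE subrr; exact: (scale0r (g m : kmod N)).
have [c0 [c0P c0U]] := zP _ (derivation_inc phiP).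
exists (row_mx c0 (\row_k t k)); split=> [|c /innP[/c0U c0E <-]].
  by apply/innP; rewrite row_mxKl row_mxKr.
by rewrite c0E hsubmxK.
Qed.

End ThickenedDerivations.

Section Ext1.
Variables (K : fieldType) (A : falgType K).
Implicit Types M N : fgmod A.

Lemma ext1_dimP M N :
  qdim (@derivation K A M N : (A -> M -> kmod N) -> Prop)
    (@inner_derivation K A M N) (ext1_dim M N).
Proof.
apply: has_ext1_qdim; first exact: fgmodP.
have [d dP] := has_ext1_exists (fgmodP M) (fgmodP N).
by rewrite /ext1_dim; case: xgetP => [d' -> //|/(_ d)].
Qed.

Lemma ext1_dim_eq M N d :
  qdim (@derivation K A M N : (A -> M -> kmod N) -> Prop)
    (@inner_derivation K A M N) d -> ext1_dim M N = d.
Proof. exact/(qdim_uniq (inner_derivation_subsp M N))/ext1_dimP. Qed.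

End Ext1.

(** Schur's lemma: for an eigenvalue [c] of [h], the endomorphism [h - c] is not injective, hence
    not invertible, hence zero. *)
Lemma brick_endo (K : closedFieldType) (A : falgType K) (M : fgmod A)
    (h : {linear M -> M}) : brick M -> exists c, forall m, h m = kscale c m.
Proof.
move=> [M_n0 Mdiv]; have [r Mfd] := fin_dim_fgmod M.
have [c [x [x_n0 hx]]] := endo_eigenvalue (kfun h) Mfd M_n0; exists c.
have l_lin : linear (fun m : M => h m - kscale c m).
  move=> a m n; rewrite linearP kscaleDr -kscale_comm scalerBr opprD.
  by rewrite addrACA.
have [l0 m|/(Mdiv (lin_of l_lin))[g [gK _]]] :=
    EM (forall m, lin_of l_lin m = 0).
  by apply/eqP; rewrite -subr_eq0; apply/eqP/l0.
case/eqP: x_n0; apply: (can_inj gK); rewrite lin_ofE.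
by rewrite -[h x]/(kfun h x) hx linear0 subrr.
Qed.

Section RestrictedSemibricks.
Variables (K : fieldType) (A B : falgType K) (f : {lrmorphism B -> A}).

Lemma semibrick_restr k (S : 'I_k -> fgmod A) :
  (forall i j (g : {linear restr f (S i) -> restr f (S j)}),
    linear (g : S i -> S j)) ->
  semibrick S -> semibrick (fun i => restr_fgmod f (S i)).
Proof.
move=> gl [S_brick S_hom]; split=> [i|i j /S_hom[noiso hom0]].
  have [Si_n0 Sdiv] := S_brick i; split=> // g g_n0.
  have [h [gK hK]] := Sdiv (lin_of (gl _ _ g)) g_n0.
  by exists (lin_of (restr_linear (f := f) h)).
split=> [[g g_bij]|g v]; last exact: (hom0 (lin_of (gl _ _ g))).
by apply: noiso; exists (lin_of (gl _ _ g)).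
Qed.

End RestrictedSemibricks.

Section ThickenedSemibricks.
Variables (K : closedFieldType) (A A' : falgType K) (n : nat).
Variable T : thickening A A' n.

(** By centrality [eps T i] acts as an endomorphism. Were it nonzero, it would be injective, and no
    power of it could vanish. *)
Lemma eps_brick (M : lmodType A'^c) i (m : M) :
  brick M -> (eps T i : A'^c) *: m = 0.
Proof.
move=> [[v v_n0] Mdiv].
have l_lin : linear (fun m : M => (eps T i : A'^c) *: m).
  move=> a x y; rewrite scalerDr !scalerA; congr (_ *: _ + _).
  by apply/esym; exact: epsC.
have [l0|/(Mdiv (lin_of l_lin))[g [gK _]]] := EM (forall m, lin_of l_lin m = 0).
  exact: l0.
have [k ek] := eps_nilpotent T i.
suff : (eps T i ^+ k : A'^c) *: v != 0 by rewrite ek scale0r eqxx.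
elim: k {ek} => [|k IH]; first by rewrite expr0 scale1r.
apply: contra_neq IH => e0; apply: (can_inj gK).
rewrite linear0 lin_ofE scalerA -[RHS]e0; congr (_ *: _).
by rewrite exprSr.
Qed.

Lemma brick_red (M : lmodType A'^c) (b : A'^c) (m : M) :
  brick M -> b *: m = (inc T (red T b) : A'^c) *: m.
Proof.
move=> M_brick; have [c {1}->] := thickeningE T b.
rewrite [LHS]scalerDl scaler_suml big1 ?addr0 // => i _.
rewrite epsC -[_ *: m]/(((eps T i : A'^c) * c i) *: m).
by rewrite -scalerA eps_brick.
Qed.

Lemma semibrick_thicken k (S : 'I_k -> fgmod A) :
  semibrick S -> semibrick (fun i => restr_fgmod (red T) (S i)).
Proof. by apply: semibrick_restr => i j g; exact: linear_restr (incK T). Qed.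

Lemma semibrick_reduce k (S : 'I_k -> fgmod A') :
  semibrick S -> semibrick (fun i => restr_fgmod (inc T) (S i)).
Proof.
move=> S_sb; have [S_brick _] := S_sb; apply: semibrick_restr S_sb => i j g b x y.
rewrite [b *: x]brick_red // [b *: g x]brick_red //.
exact: (linearP g (red T b : A^c)).
Qed.

(** On the diagonal the endomorphisms of a brick are scalars by Schur's lemma, which adds one
    dimension per variable; off the diagonal there are no nonzero morphisms and nothing is added. *)
Lemma ext_quiver_thicken k (S : 'I_k -> fgmod A) : semibrick S ->
  ext_quiver (fun i => restr_fgmod (red T) (S i)) =
  \matrix_(i, j) (ext_quiver S i j + n * (i == j))%N.
Proof.
move=> [S_brick S_hom]; apply/matrixP=> i j; rewrite !mxE; apply: ext1_dim_eq.
have [<-|ij] := eqVneq i j.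
  rewrite muln1; apply: (@qdim_thicken1 _ _ _ _ T _ _ _ idfun) (ext1_dimP _ _).
    by have [] := S_brick i.
  by move=> h; exact: brick_endo.
rewrite muln0 addn0; apply: qdim_thicken0 (ext1_dimP _ _) => g m.
by have [_ ->] := S_hom _ _ ij.
Qed.

(** A brick over [A'] and its round trip through [A] have the same elements and, by [brick_red],
    equal but not convertible actions; the identity transports derivations. *)
Lemma ext_quiver_reduce k (S : 'I_k -> fgmod A') : semibrick S ->
  ext_quiver S =
  ext_quiver (fun i => restr_fgmod (red T) (restr_fgmod (inc T) (S i))).
Proof.
move=> [S_brick _]; apply/matrixP=> i j; rewrite !mxE; apply: ext1_dim_eq.
set M' := restr_fgmod _ _ : fgmod A'; set N' := restr_fgmod _ (_ (S j)) : fgmod A'.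
have ks c (x : S j) : kscale c (x : N') = kscale c x :> S j.
  by rewrite !restr_kscale.
have ksM c (x : S i) : kscale c (x : M') = kscale c x :> S i.
  by rewrite !restr_kscale.
have actM b (x : S i) : b *: (x : M') = b *: x :> S i by rewrite [RHS]brick_red.
have actN b (x : S j) : b *: (x : N') = b *: x :> S j by rewrite [RHS]brick_red.
have Phi_lin : linear (id : (A' -> M' -> kmod N') -> A' -> S i -> kmod (S j)).
  move=> c f g; apply/funext=> b; apply/funext=> m.
  by rewrite -[LHS]/(kscale c (f b m : N') + g b m : N') ks.
apply: (qdim_transfer (Phi := lin_of Phi_lin)) (ext1_dimP M' N').
- exact: derivation_subsp.
- exact: inner_derivation_subsp.
- move=> phi [pl pD pM]; split=> // [c a b m|a b m]; rewrite lin_ofE.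
    by rewrite pl ks.
  by rewrite pM actM actN.
- move=> phi [pl pD pM]; exists phi; last first.
    by rewrite lin_ofE subrr; case: (inner_derivation_subsp (S i) (S j)).
  split=> // [c a b m|a b m]; first by rewrite pl ks.
  by rewrite pM actM actN.
- move=> phi _; split=> -[h hP].
    have h_lin : linear (h : kmod (S i) -> kmod (S j)).
      move=> c x y; rewrite -[LHS]/(h (kscale c (x : S i) + y)).
      rewrite -[RHS]/(kscale c (h x : S j) + h y) -ks -ksM.
      exact: (linearP h).
    by exists (lin_of h_lin) => b m; rewrite -actM -actN; exact: hP.
  have h_lin : linear (h : kmod M' -> kmod N').
    move=> c x y; rewrite -[LHS]/(h (kscale c (x : M') + y)).
    rewrite -[RHS]/(kscale c (h x : N') + h y) ks ksM.
    exact: (linearP h).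
  by exists (lin_of h_lin) => b m; rewrite actM actN; exact: hP.
Qed.

End ThickenedSemibricks.

(** * Existence of a brick *)

Section Kernel.
Variables (R : nzRingType) (M N : lmodType R) (f : {linear M -> N}).

Definition in_kernel : {pred M} := fun x => f x == 0.

Fact in_kernel_submod : submod_closed in_kernel.
Proof.
split=> [|a x y]; rewrite !unfold_in; first by rewrite linear0.
by move=> /eqP fx /eqP fy; rewrite linearP fx fy scaler0 addr0.
Qed.

HB.instance Definition _ := GRing.isSubmodClosed.Build R M in_kernel
  in_kernel_submod.

Record kernel := Kernel { kernel_val :> M; _ : kernel_val \in in_kernel }.

HB.instance Definition _ := [isSub for kernel_val].
HB.instance Definition _ := [Choice of kernel by <:].
HB.instance Definition _ := [SubChoice_isSubLmodule of kernel by <:].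

End Kernel.

(** Take a nonzero module of least dimension. The kernel of a nonzero endomorphism has smaller
    dimension, hence is zero, and an injective endomorphism is bijective. *)
Lemma exists_brick (K : fieldType) (A : falgType K) : exists M : fgmod A, brick M.
Proof.
pose dim_of (r : nat) : bool := `[< exists M : fgmod A,
  (exists v : M, v != 0) /\ fin_dim (kmod M) r >].
have dim_ex : exists r, dim_of r.
  have [r rP] := fin_dim_fgmod (free_module A 1).
  exists r; apply/asboolP; exists (free_module A 1); split=> //.
  exists (const_mx 1); apply/eqP=> /matrixP/(_ 0 0)/eqP.
  by rewrite !mxE oner_eq0.
case: (ex_minnP dim_ex) => r /asboolP[M [M_n0 Mfd]] r_min.
exists M; split=> // f f_n0.
have fI : injective f.
  move=> x y fxy; apply/eqP; rewrite -subr_eq0; apply: contra_notT f_n0 => xy_n0.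
  have [V [g [rV [g' gK g'K]]]] := Mfd.
  have F_lin : linear (fun x : kmod (kernel f) => g' (kernel_val x)).
    by move=> c u v; exact: (inv_linear gK g'K).
  have F_inj : injective (lin_of F_lin).
    by move=> u v /(can_inj g'K) uv; exact: val_inj.
  have [U [UP Ufd]] := fin_dim_inj F_inj.
  have ker_xy : x - y \in in_kernel f by rewrite unfold_in linearB fxy subrr.
  have ker_fg : finitely_generated (kernel f) by apply/fin_dimP; exists (\dim U).
  have /r_min : dim_of (\dim U).
    apply/asboolP; exists (FGMod ker_fg); split=> //.
    by exists (Kernel ker_xy); rewrite -(inj_eq val_inj).
  (* By minimality a nonzero kernel has full dimension, forcing [f = 0]. *)
  rewrite -rV => leU v; have /eqP UV : U == fullv by rewrite eqEdim subvf.
  have /UP[u uv] : g' v \in U by rewrite UV memvf.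
  rewrite -[v]g'K -uv lin_ofE g'K; case: u {uv} => u /=.
  by rewrite unfold_in => /eqP.
have f_surj := injective_endo_surj (f := kfun f) Mfd fI.
have [g fK gK] := bij_of_injsurj fI f_surj.
by exists (lin_of (inv_linear fK gK)).
Qed.

(** * Perron-Frobenius *)

Section PerronFrobenius.
Variables (R : realType) (k : nat).
Implicit Types (b : 'M[R]_k) (z w : 'rV[R]_k).

Definition nonneg_mx p q (a : 'M[R]_(p, q)) : Prop := forall i j, 0 <= a i j.

(* t%:M - b is inverse-positive, stated without the inverse. *)
Definition inverse_positive b (t : R) : Prop :=
  forall z, nonneg_mx (z *m (t%:M - b)) -> nonneg_mx z.

Lemma row_mul_shift b z t j :
  (z *m (t%:M - b)) 0 j = t * z 0 j - (z *m b) 0 j.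
Proof. by rewrite mulmxBr mul_mx_scalar !mxE. Qed.

(* Look at a minimal entry of z. *)
Lemma nonneg_of_contraction b z (c : R) : nonneg_mx b ->
  (forall j, c * z 0 j >= (z *m b) 0 j) -> (forall j, \sum_i b i j < c) ->
  nonneg_mx z.
Proof.
move=> b0 zb bc i j; rewrite ord1 {i}.
have [i iP] : exists i, forall j, z 0 i <= z 0 j.
  by exists [arg min_(i < j) z 0 i]%O; case: arg_minP => // i _ iP l; exact: iP.
apply: le_trans (iP j); rewrite leNgt; apply/negP => zi0.
have := zb i; rewrite leNgt => /negP; apply.
apply: (@lt_le_trans _ _ (z 0 i * \sum_l b l i)).
  by rewrite mulrC ltr_nM2l.
by rewrite mulr_sumr mxE ler_sum // => l _; rewrite ler_wpM2r.
Qed.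

Lemma inverse_positive_large b t : nonneg_mx b ->
  (forall j, \sum_i b i j < t) -> inverse_positive b t.
Proof.
move=> b0 bt z z0; apply: (nonneg_of_contraction b0 _ bt) => j.
by have := z0 0 j; rewrite row_mul_shift subr_ge0.
Qed.

(** With [G] the inverse of [t - b], the row [z (s - b) G = z - (t - s) z G] is nonnegative, so the
    contraction argument applies to [(t - s) G] with constant 1. *)
Lemma inverse_positive_step b (s t : R) : inverse_positive b t -> s <= t ->
  t%:M - b \in unitmx ->
  (forall j, (t - s) * \sum_i invmx (t%:M - b) i j < 1) -> inverse_positive b s.
Proof.
move=> bt st tb_unit small z z0; set G := invmx (t%:M - b).
(* Row [i] of [G] times [t - b] is a unit vector, so inverse positivity at [t] applies to it. *)
have G0 : nonneg_mx G.
  move=> i j; have := bt (row i G); rewrite -row_mul mulVmx // => G0.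
  have := G0 _ 0 j; rewrite mxE; apply=> l m.
  by rewrite !mxE ler0n.
apply: (@nonneg_of_contraction ((t - s) *: G) z 1) => [i j|j|j].
- by rewrite mxE mulr_ge0 ?subr_ge0.
- rewrite mul1r -subr_ge0; set u := z *m (s%:M - b) in z0.
  have -> : z 0 j - (z *m ((t - s) *: G)) 0 j = (u *m G) 0 j.
    have uE : u = z *m (t%:M - b) - (t - s) *: z.
      rewrite -(mul_mx_scalar (t - s) z) -mulmxBr /u; congr (z *m _).
      by rewrite raddfB /= opprB [RHS]addrC addrA subrK.
    by rewrite uE mulmxBl mulmxK // -scalemxAl -scalemxAr !mxE.
  by rewrite mxE sumr_ge0 // => l _; rewrite mulr_ge0.
- by under eq_bigr do rewrite mxE; rewrite -mulr_sumr.
Qed.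

Lemma char_poly_mx_horner b (t : R) :
  map_mx (horner_eval t) (char_poly_mx b) = t%:M - b.
Proof.
apply/matrixP=> i j; rewrite !mxE /horner_eval.
by rewrite !(hornerE, hornerMn).
Qed.

Lemma unitmx_shift b (t : R) :
  (t%:M - b \in unitmx) = ~~ root (char_poly b) t.
Proof.
by rewrite unitmxE unitfE -char_poly_mx_horner det_map_mx /root.
Qed.

Lemma inverse_bounded b (r T : R) : r <= T ->
  (forall t, r <= t -> ~~ root (char_poly b) t) ->
  exists2 C : R, 0 < C & forall t, r <= t <= T ->
    forall j, \sum_i invmx (t%:M - b) i j < C.
Proof.
move=> rT noroot; pose P j := \sum_i (\adj (char_poly_mx b)) i j.
pose f j t := (P j).[t] / (char_poly b).[t].
have fE t j : r <= t -> \sum_i invmx (t%:M - b) i j = f j t.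
  move=> rt; rewrite /invmx unitmx_shift noroot // /f /P [RHS]mulrC.
  rewrite [X in _ * X]horner_sum mulr_sumr.
  apply: eq_bigr => i _; rewrite mxE -char_poly_mx_horner det_map_mx.
  by rewrite -map_mx_adj mxE.
have f_max j : exists c, forall t, r <= t <= T -> f j t <= f j c.
  have [|c _ cP] := EVT_max (f := f j) rT; last first.
    by exists c => t rtT; apply: cP; rewrite in_itv.
  apply: continuous_in_subspaceT => t; rewrite inE /= in_itv => /andP[rt _].
  apply: cvgM; first exact: continuous_horner.
  by apply: cvgV; [exact: noroot | exact: continuous_horner].
have [c cP] := choice f_max.
exists (1 + \sum_j `|f j (c j)|).
  by rewrite ltr_wpDr // sumr_ge0.
move=> t rtT j; rewrite fE; last by case/andP: rtT.
apply: le_lt_trans (cP j t rtT) _; rewrite (bigD1 j) //=.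
apply: le_lt_trans (ler_norm _) _; rewrite addrCA ltrDl.
by rewrite ltr_wpDr // sumr_ge0.
Qed.

(* Inverse positivity holds for large t and propagates downwards by steps of
   fixed size 1 / C, where C bounds the column sums of the inverses. *)
Lemma inverse_positive_above b (r : R) : nonneg_mx b ->
  (forall t, r <= t -> ~~ root (char_poly b) t) -> inverse_positive b r.
Proof.
(* [T] is at least [r] and exceeds every column sum, so inverse positivity holds at [T]. *)
move=> b0 noroot; pose T := Num.max r (1 + \sum_j \sum_i b i j).
have rT : r <= T by rewrite le_max lexx.
have bT j : \sum_i b i j < T.
  rewrite lt_max; apply/orP; right; rewrite [X in _ < 1 + X](bigD1 j) //=.
  rewrite addrCA ltrDl.
  by rewrite ltr_wpDr // sumr_ge0 // => l _; rewrite sumr_ge0.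
have [C C0 CP] := inverse_bounded rT noroot.
(* The induction covers the part of [[r, T]] within [n / C] of [T]; by the Archimedean property some
   [n] reaches [r]. *)
suff step n t : r <= t <= T -> T - n%:R / C <= t -> inverse_positive b t.
  apply: (step (Num.bound ((T - r) * C))); first by rewrite lexx.
  rewrite lerBlDl -lerBlDr ler_pdivlMr //; apply/ltW.
  by apply: archi_boundP; rewrite mulr_ge0 ?subr_ge0 // ltW.
elim: n t => [|n IH] t /andP[rt tT].
  rewrite mul0r subr0 => Tt; have -> : t = T by apply/le_anti/andP.
  exact: inverse_positive_large.
move=> Tt; pose t' := Num.min T (t + C^-1).
have tt' : t <= t' by rewrite le_min tT lerDl invr_ge0 ltW.
have t'T : r <= t' <= T by rewrite (le_trans rt tt') ge_min lexx.
apply: (inverse_positive_step (t := t')) => // [||j].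
- apply: IH => //; rewrite le_min lerBlDr lerDl divr_ge0 ?ler0n ?(ltW C0) //=.
  by move: Tt; rewrite -natr1 mulrDl mul1r opprD addrA lerBlDr.
- by rewrite unitmx_shift noroot //; case/andP: t'T.
move: tt'; rewrite le_eqVlt => /orP[/eqP <-|tt']; first by rewrite subrr mul0r.
apply: (@lt_le_trans _ _ ((t' - t) * C)); first by rewrite ltr_pM2l ?subr_gt0 ?CP.
by rewrite -ler_pdivlMr // div1r lerBlDl ge_min lexx orbT.
Qed.

(** Without such a root, inverse positivity at [r] applies to [- w], since
    [- w (r - b) = w b - r w]; so [w] would be zero. *)
Lemma real_eigenvalue_ge b w (r : R) : nonneg_mx b -> nonneg_mx w -> w != 0 ->
  nonneg_mx (w *m b - r *: w) -> exists2 t, r <= t & root (char_poly b) t.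
Proof.
move=> b0 w0 w_n0 wb; apply: contrapT => noroot.
case/eqP: w_n0; apply/matrixP=> i j; apply/eqP; rewrite mxE eq_le w0 andbT.
have /inverse_positive_above : forall t, r <= t -> ~~ root (char_poly b) t.
  by move=> t rt; apply/negP=> tb; apply: noroot; exists t.
move=> /(_ b0 (- w)) H; rewrite -oppr_ge0; have := H _ i j.
rewrite mxE; apply; rewrite mulNmx mulmxBr mul_mx_scalar opprB.
exact: wb.
Qed.

End PerronFrobenius.

Section SpectralRadius.
Variable R : realType.
Local Notation C := (R[i]).

Lemma normc_realC (x : R) : Normc.normc (x%:C)%C = `|x|.
Proof. by rewrite /= expr0n addr0 sqrtr_sqr. Qed.

Lemma normc_ge0 (z : C) : 0 <= Normc.normc z.
Proof. by case: z => a b; rewrite /= sqrtr_ge0. Qed.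

Lemma le_normc_sum (I : finType) (F : I -> C) :
  Normc.normc (\sum_i F i) <= \sum_i Normc.normc (F i).
Proof.
elim/big_ind2: _ => [|x r y s xr ys|//]; first by rewrite Normc.normc0.
by apply: le_trans (lerD xr ys); exact: le_normcD.
Qed.

Lemma real_eigenvalue_ge_normc k (b : 'M[R]_k) (l : C) : nonneg_mx b ->
  eigenvalue (map_mx (real_complex R) b) l ->
  exists2 t : R, Normc.normc l <= t & root (char_poly b) t.
Proof.
move=> b0 /eigenvalueP[v vE v_n0]; pose w := map_mx (@Normc.normc R) v.
apply: (@real_eigenvalue_ge _ _ _ w) => //.
- by move=> i j; rewrite mxE normc_ge0.
- apply: contra_neq v_n0 => /matrixP w0; apply/matrixP=> i j.
  by have := w0 i j; rewrite !mxE => /Normc.eq0_normc.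
move=> i j; rewrite !mxE subr_ge0 -Normc.normcM.
have := congr1 (fun u : 'rV[C]_k => Normc.normc (u i j)) vE; rewrite !mxE => <-.
apply: le_trans (le_normc_sum _) _; apply: ler_sum => m _.
by rewrite !mxE Normc.normcM normc_realC ger0_norm.
Qed.

Lemma seq_max_normc (s : seq C) : s != [::] ->
  exists2 x, x \in s & forall y, y \in s -> Normc.normc y <= Normc.normc x.
Proof.
elim: s => // z s IH _; have [->|/IH[x xs xP]] := eqVneq s [::].
  by exists z; rewrite ?mem_head // => y; rewrite inE => /eqP ->.
have [zx|/ltW xz] := leP (Normc.normc z) (Normc.normc x).
  exists x; first by rewrite inE xs orbT.
  by move=> y; rewrite inE => /predU1P[->|/xP].
exists z; first by rewrite mem_head.
by move=> y; rewrite inE => /predU1P[->|/xP/le_trans->].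
Qed.

Let complex_mx k (a : 'M[nat]_k) : 'M[C]_k := map_mx (fun m : nat => m%:R) a.

(** An eigenvalue [l0] of largest modulus exists since [k > 0]. A real eigenvalue [t] at least as
    large as that modulus then bounds all moduli. *)
Lemma perron_root k (a : 'M[nat]_k) : (0 < k)%N ->
  exists rho : R, [/\ 0 <= rho, eigenvalue (complex_mx a) (rho%:C)%C &
    forall l, eigenvalue (complex_mx a) l -> Normc.normc l <= rho].
Proof.
move=> k_gt0; pose b : 'M[R]_k := map_mx (fun m : nat => m%:R) a.
have aE : complex_mx a = map_mx (real_complex R) b.
  by apply/matrixP=> i j; rewrite !mxE rmorph_nat.
have [s sE] := closed_field_poly_normal (char_poly (complex_mx a)).
have sP l : (l \in s) = eigenvalue (complex_mx a) l.
  rewrite eigenvalue_root_char sE (monicP (char_poly_monic _)) scale1r.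
  by rewrite root_prod_XsubC.
have s_n0 : s != [::].
  apply: contraTneq k_gt0 => s0; move: sE; rewrite s0 big_nil alg_polyC.
  rewrite (monicP (char_poly_monic _)) => /(congr1 (size \o val)) /=.
  by rewrite size_char_poly size_poly1 => -[->].
have [l0 l0s l0P] := seq_max_normc s_n0.
have b0 : nonneg_mx b by move=> i j; rewrite mxE ler0n.
have [|t lt tb] := @real_eigenvalue_ge_normc k b l0 b0; first by rewrite -aE -sP.
exists t; split; first exact: le_trans (normc_ge0 _) lt.
  by rewrite aE eigenvalue_map eigenvalue_root_char.
by move=> l; rewrite -sP => /l0P ll0; exact: le_trans ll0 lt.
Qed.

Lemma spectral_radius_eq k (a : 'M[nat]_k) (rho : R) : 0 <= rho ->
  eigenvalue (complex_mx a) (rho%:C)%C ->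
  (forall l, eigenvalue (complex_mx a) l -> Normc.normc l <= rho) ->
  spectral_radius R a = rho.
Proof.
move=> rho0 rhoE rhoP; apply/le_anti/andP; split.
  apply: ge_sup; first by exists (Normc.normc (rho%:C)%C), (rho%:C)%C.
  by move=> _ [l lE <-]; exact: rhoP.
apply: ub_le_sup; first by exists rho => _ [l lE <-]; exact: rhoP.
by exists (rho%:C)%C => //; rewrite normc_realC ger0_norm.
Qed.

Lemma spectral_radius_ge0 k (a : 'M[nat]_k) : 0 <= spectral_radius R a.
Proof.
case: k a => [|k] a; first by rewrite spectral_radius0.
have [rho [rho0 rhoE rhoP]] := perron_root a (ltn0Sn k).
by rewrite (spectral_radius_eq rho0 rhoE rhoP).
Qed.

(** Adding [n] times the identity translates the spectrum by [n], and the Perron root stays largest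
    by the triangle inequality. For [k = 0] both radii are 0, whence the condition on [k]. *)
Lemma spectral_radius_shift k (a : 'M[nat]_k) n : (0 < k)%N ->
  spectral_radius R (\matrix_(i, j) (a i j + n * (i == j))%N) =
  spectral_radius R a + n%:R.
Proof.
move=> k_gt0; have [rho [rho0 rhoE rhoP]] := perron_root a k_gt0.
rewrite (spectral_radius_eq rho0 rhoE rhoP); set a' := \matrix_(i, j) _.
have a'E l : eigenvalue (complex_mx a') l = eigenvalue (complex_mx a) (l - n%:R).
  have E : complex_mx a' = complex_mx a + n%:R%:M.
    by apply/matrixP=> i j; rewrite !mxE natrD natrM mulr_natr.
  apply/eigenvalueP/eigenvalueP => -[v vE v_n0]; exists v => //; move: vE.
    by rewrite E mulmxDr mul_mx_scalar scalerBl => <-; rewrite addrK.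
  by rewrite E mulmxDr mul_mx_scalar scalerBl => ->; rewrite subrK.
apply: spectral_radius_eq => [||l].
- by rewrite addr_ge0.
- by rewrite a'E rmorphD rmorph_nat addrK.
rewrite a'E => /rhoP lrho; rewrite -[l in Normc.normc l](subrK n%:R).
apply: (@le_trans _ _ (Normc.normc (l - n%:R) + Normc.normc (n%:R : C))).
  exact: le_normcD.
rewrite lerD //.
by rewrite -(rmorph_nat (real_complex R)) normc_realC normr_nat.
Qed.

End SpectralRadius.

(** * Frobenius-Perron dimension *)

Section FrobeniusPerron.
Variables (R : realType) (K : closedFieldType).
Local Open Scope ereal_scope.

Lemma le_FPdim (A : falgType K) k (S : 'I_k -> fgmod A) : semibrick S ->
  (spectral_radius R (ext_quiver S))%:E <= FPdim R A.
Proof. by move=> S_sb; apply: ereal_sup_ubound; exists k, S. Qed.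

Lemma FPdim_ge0 (A : falgType K) : 0 <= FPdim R A.
Proof.
have [M M_brick] := exists_brick A.
apply: le_trans (le_FPdim (S := fun _ : 'I_1 => M) _).
  by rewrite lee_fin spectral_radius_ge0.
by split=> // i j; rewrite (ord1 i) (ord1 j) eqxx.
Qed.

(** Inflating semibricks of [A] gives one inequality. For the other, a semibrick of [A'] has the
    Ext-quiver of its reduction to [A], with [n] loops added at each vertex. *)
Lemma FPdim_thickening (A A' : falgType K) n : thickening A A' n ->
  FPdim R A' = FPdim R A + n%:R%:E.
Proof.
move=> T; have [M M_brick] := exists_brick A.
have thicken_le k (S : 'I_k -> fgmod A) : (0 < k)%N -> semibrick S ->
    (spectral_radius R (ext_quiver S) + n%:R)%:E <= FPdim R A'.
  move=> k_gt0 S_sb; rewrite -spectral_radius_shift //.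
  rewrite -(ext_quiver_thicken T S_sb).
  exact/le_FPdim/semibrick_thicken.
apply/le_anti/andP; split.
  apply: ge_ereal_sup => _ [k [S [S_sb ->]]].
  have [k0|k_gt0] := posnP k.
    rewrite (_ : spectral_radius _ _ = 0%R); last first.
      by subst k; exact: spectral_radius0.
    by rewrite adde_ge0 ?FPdim_ge0 // lee_fin.
  rewrite (ext_quiver_reduce T S_sb).
  rewrite (ext_quiver_thicken T (semibrick_reduce T S_sb)).
  rewrite spectral_radius_shift // EFinD leeD2r //.
  exact/le_FPdim/semibrick_reduce.
rewrite -leeBrDr //; apply: ge_ereal_sup => _ [k [S [S_sb ->]]].
rewrite leeBrDr // -EFinD.
have [k0|k_gt0] := posnP k; last exact: thicken_le.
rewrite (_ : spectral_radius _ _ = 0%R); last first.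
  by subst k; exact: spectral_radius0.
(* The empty semibrick has radius 0, which does not grow by [n] under inflation; a single brick of
   [A] takes its place. *)
apply: le_trans (@thicken_le 1%N (fun=> M) isT _).
  by rewrite lee_fin lerD2r spectral_radius_ge0.
by split=> // i j; rewrite (ord1 i) (ord1 j) eqxx.
Qed.

(** A derivation on [K] is [K]-linear and vanishes at 1, hence is zero. *)
Lemma ext1_dim_regular (M N : fgmod K^o) : ext1_dim M N = 0%N.
Proof.
apply: ext1_dim_eq; exists (fun=> 0%R); split=> [[]//|phi phiP].
have phi0 : phi = 0%R.
  apply/funext=> c; apply/funext=> m; have [pl _ _] := phiP.
  have := pl c 1%R 0%R m.
  rewrite (derivation0l _ phiP) (derivation1 phiP) /kscale scaler0 !addr0.
  by rewrite -[c *: _]/(c * 1)%R mulr1.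
exists 0%R; split=> [|c _]; last by rewrite thinmx0.
by rewrite big_ord0 subr0 phi0; case: (inner_derivation_subsp M N).
Qed.

Lemma FPdim_regular : FPdim R (K^o : falgType K) = 0.
Proof.
apply/le_anti/andP; split; last exact: FPdim_ge0.
apply: ge_ereal_sup => _ [k [S [S_sb ->]]].
have [k0|k_gt0] := posnP k.
  by subst k; rewrite spectral_radius0.
rewrite (spectral_radius_eq (rho := 0%R)) // => [|l].
  apply/eigenvalueP; exists (const_mx 1%R); last first.
    by apply/eqP=> /matrixP/(_ 0%R (Ordinal k_gt0))/eqP; rewrite !mxE oner_eq0.
  rewrite scale0r; apply/matrixP=> i j; rewrite !mxE big1 // => m _.
  by rewrite !mxE ext1_dim_regular mulr0.
move=> /eigenvalueP[v vE v_n0].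
suff -> : l = 0%R by rewrite Normc.normc0.
apply/eqP; apply: contraNT v_n0 => l0; rewrite -(scalerK l0 v) -vE.
apply/eqP; apply/matrixP=> i j; rewrite !mxE big1 ?mulr0 // => m _.
by rewrite !mxE ext1_dim_regular mulr0.
Qed.

End FrobeniusPerron.

(** * The two families of thickenings *)

Definition lrmorph_of (K : fieldType) (A B : falgType K) (f : A -> B)
    (f_lin : linear f) (f_mul : monoid_morphism f) : {lrmorphism A -> B} :=
  HB.pack f (GRing.isLinear.Build K A B _ f f_lin)
    (GRing.isMonoidMorphism.Build A B f f_mul).

Lemma lrmorph_ofE (K : fieldType) (A B : falgType K) (f : A -> B)
    (f_lin : linear f) (f_mul : monoid_morphism f) a :
  lrmorph_of f_lin f_mul a = f a.
Proof. by []. Qed.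

Section TensorMap.
Variables (K : fieldType) (A B : falgType K) (g : {linear B -> K^o}).

(** The map from the tensor product to [A] sending [a (x) b] to [g b *: a]. *)
Definition tensor_map (t : tensor A B) : A :=
  \sum_i \sum_j (t i j * g (vbasis {:B})`_j) *: (vbasis {:A})`_i.

Lemma tensor_map_linear : linear tensor_map.
Proof.
move=> c t u; rewrite /tensor_map scaler_sumr -big_split; apply: eq_bigr => i _.
rewrite scaler_sumr -big_split; apply: eq_bigr => j _.
by rewrite !mxE mulrDl scalerDl -mulrA scalerA.
Qed.

Lemma tensor_map_pure a b : tensor_map (tpure a b) = g b *: a.
Proof.
rewrite /tensor_map [in RHS](coord_vbasis (memvf a)) scaler_sumr.
apply: eq_bigr => i _; rewrite -scaler_suml scalerA; congr (_ *: _).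
rewrite [in RHS](coord_vbasis (memvf b)) linear_sum mulr_suml.
by apply: eq_bigr => j _; rewrite mxE linearZ -mulrA mulrC.
Qed.

End TensorMap.

Section TruncatedPolynomials.
Variables (K : fieldType) (m : nat).
Variable m_gt1 : (1 < m)%N.
Local Notation T := (truncated_poly K m).

Definition trunc (p : {poly K}) : T := in_qpoly 'X^m p.

Lemma coef_trunc p i : (i < m)%N -> (trunc p : {poly K})`_i = p`_i.
Proof.
move=> im; have -> : trunc p = Pdiv.Ring.rmodp p 'X^m :> {poly K}.
  by rewrite /trunc /= mk_monic_Xn prednK ?(ltnW m_gt1).
rewrite [p in RHS](Pdiv.RingMonic.rdivp_eq (monicXn K m)).
by rewrite coefD coefMXn im add0r.
Qed.

Lemma truncK (b : T) : trunc (b : {poly K}) = b.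
Proof. exact/val_inj/in_qpoly_small/size_mk_monic. Qed.

Definition tcoef (i : nat) (b : T) : K := (b : {poly K})`_i.

Fact tcoef_linear i : linear (tcoef i : T -> K^o).
Proof. by move=> c a b; rewrite /tcoef /= coefD coefZ. Qed.

Lemma tcoefM0 (a b : T) : tcoef 0 (a * b) = tcoef 0 a * tcoef 0 b.
Proof.
rewrite -[a]truncK -[b]truncK -[X in tcoef _ X]in_qpolyM /tcoef.
by rewrite !coef_trunc ?(ltnW m_gt1) // coef0M.
Qed.

(** The coefficient of [x] survives reduction modulo [x^m] because [m > 1], so it can be computed on
    polynomials. *)
Lemma tcoefM1 (a b : T) :
  tcoef 1 (a * b) = tcoef 1 a * tcoef 0 b + tcoef 0 a * tcoef 1 b.
Proof.
rewrite -[a]truncK -[b]truncK -[X in tcoef _ X]in_qpolyM /tcoef.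
rewrite !coef_trunc ?(ltnW m_gt1) // coefM big_ord_recl big_ord1 /=.
by rewrite addrC subnn subn0.
Qed.

Lemma tcoef1 i : tcoef i 1 = (i == 0%N)%:R.
Proof. by rewrite /tcoef -[LHS]/((1 : {poly K})`_i) coef1. Qed.

Lemma trunc_decomp (b : T) : exists b' : T,
  b = tcoef 0 b *: 1 + trunc 'X * b'.
Proof.
exists (trunc (drop_poly 1 (b : {poly K}))).
rewrite -[trunc 'X * _]in_qpolyM -[in LHS](truncK b).
rewrite -[X in trunc X = _](poly_take_drop 1) [_ * 'X^1]mulrC expr1.
rewrite -[LHS]/(in_qpoly _ _) in_qpolyD; congr (_ + _).
rewrite -in_qpoly1 -in_qpolyZ; congr in_qpoly; apply/polyP=> i.
rewrite coef_take_poly coefZ coef1; case: i => [|i] /=; first by rewrite mulr1.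
by rewrite mulr0.
Qed.

Lemma trunc_X_nilpotent : trunc 'X ^+ m = 0.
Proof.
rewrite -[LHS](rmorphXn (in_qpoly 'X^m)); apply: val_inj => /=.
by rewrite mk_monic_Xn prednK ?(ltnW m_gt1) // Pdiv.RingMonic.rmodpp ?monicXn.
Qed.

Variable A : falgType K.
Local Notation AT := (tensor A T).

Let red_fun := tensor_map (A := A) (lin_of (tcoef_linear 0)).
Let dpart_fun := tensor_map (A := A) (lin_of (tcoef_linear 1)).

Let red_pure a b : red_fun (tpure a b) = tcoef 0 b *: a.
Proof. exact: tensor_map_pure. Qed.

Let dpart_pure a b : dpart_fun (tpure a b) = tcoef 1 b *: a.
Proof. exact: tensor_map_pure. Qed.

Let red_linear : linear red_fun. Proof. exact: tensor_map_linear. Qed.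

Let red_mul : monoid_morphism red_fun.
Proof.
split; first by rewrite -tpure1 red_pure tcoef1 scale1r.
move=> t u; elim/tensor_ind: t => [c t t' IH IH'|a b].
  by rewrite mulrDl -scalerAl !red_linear IH IH' mulrDl scalerAl.
elim/tensor_ind: u => [c u u' IH IH'|a' b'].
  by rewrite mulrDr -scalerAr !red_linear IH IH' mulrDr scalerAr.
rewrite tpureM !red_pure tcoefM0 -scalerAl -scalerAr scalerA.
by [].
Qed.

Let inc_mul : monoid_morphism (fun a : A => tpure a 1 : AT).
Proof. by split=> // a b; rewrite tpureM mulr1. Qed.

Let dpart_linear : linear dpart_fun. Proof. exact: tensor_map_linear. Qed.

(** The variable is [1 (x) x]; [red] and [dpart] take the coefficients of 1 and [x] in the second
    factor. Identities in general tensors are checked on pure ones by linearity. *)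
Lemma tensor_thickening : thickening A AT 1.
Proof.
apply: (@Thickening _ _ _ _ (lrmorph_of (tpure_linearl 1) inc_mul)
  (lrmorph_of red_linear red_mul) (fun=> tpure 1 (trunc 'X))
  (fun=> lin_of dpart_linear)).
- by move=> a; rewrite -[LHS]/(red_fun (tpure a 1)) red_pure tcoef1 scale1r.
- move=> _ t; elim/tensor_ind: t => [c t u IH IH'|a b].
    by rewrite mulrDr mulrDl -scalerAl -scalerAr IH IH'.
  by rewrite !tpureM mulr1 mul1r mulrC.
- move=> _; exists m.
  have -> k : tpure (1 : A) (trunc 'X) ^+ k = tpure 1 (trunc 'X ^+ k).
    elim: k => [|k IH]; first by rewrite !expr0 tpure1.
    by rewrite !exprS IH tpureM mulr1.
  rewrite trunc_X_nilpotent; apply/matrixP=> i j.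
  by rewrite !mxE linear0 mulr0.
- move=> _; rewrite -[LHS]/(red_fun _) red_pure /tcoef coef_trunc ?coefX //.
    exact: scale0r.
  exact: ltnW.
- move=> t; suff [u tE] : exists u,
      t = tpure (red_fun t) 1 + tpure 1 (trunc 'X) * u.
    by exists (fun=> u); rewrite big_ord1; exact: tE.
  elim/tensor_ind: t => [c t u [t' tE] [u' uE]|a b].
    exists (c *: t' + u'); rewrite red_linear (tpure_linearl _ c) {1}tE {1}uE.
    by rewrite mulrDr -scalerAr scalerDr addrACA.
  have [b' bE] := trunc_decomp b; exists (tpure a b').
  rewrite tpureM mul1r red_pure {1}bE.
  have -> : tpure (tcoef 0 b *: a) 1 = tpure a (tcoef 0 b *: 1) :> AT.
    by apply/matrixP=> i j; rewrite !mxE !linearZ /= mulrCA mulrA.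
  by apply/matrixP=> i j; rewrite !mxE linearD mulrDr.
- move=> _ t u; rewrite !lin_ofE !lrmorph_ofE.
  elim/tensor_ind: t => [c t t' IH IH'|a b].
    rewrite mulrDl -scalerAl !red_linear !dpart_linear IH IH' !mulrDl -!scalerAl.
    by rewrite scalerDr addrACA.
  elim/tensor_ind: u => [c u u' IH IH'|a' b'].
    rewrite mulrDr -scalerAr !red_linear !dpart_linear IH IH' !mulrDr -!scalerAr.
    by rewrite scalerDr addrACA.
  rewrite tpureM !dpart_pure !red_pure tcoefM1 scalerDl.
  by rewrite -!scalerAl -!scalerAr !scalerA.
- move=> i j; rewrite (ord1 i) (ord1 j) lin_ofE dpart_pure /tcoef.
  by rewrite coef_trunc // coefX scale1r.
- move=> _ a; rewrite lin_ofE lrmorph_ofE dpart_pure tcoef1.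
  exact: scale0r.
Qed.

End TruncatedPolynomials.

Section SquareZeroThickening.
Variables (K : fieldType) (n : nat).
Local Notation Q := (square_zero_alg K n).
Local Notation proj := (@square_zero_proj K n).

Let ev0 (p : mpoly n K) : K := meval (fun=> 0) p.

(** Divide each nonconstant monomial by some variable occurring in it. *)
Lemma mpoly_decomp (p : mpoly n K) :
  exists q : 'I_n -> mpoly n K, p = ev0 p *: 1 + \sum_i mpolyX K (mnm1 i) * q i.
Proof.
elim/mpolyind: p => [|c m p _ _ [q pE]].
  exists (fun=> 0); rewrite /ev0 meval0 scale0r add0r big1 // => i _.
  by rewrite mulr0.
have [->|m_n0] := eqVneq m mnm0.
  exists q; rewrite mpolyX0 {1}pE addrA -scalerDl /ev0 mevalD mevalZ meval1.
  by rewrite mulr1.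
have [i mi] : exists i, m i != 0%N.
  apply/existsP; apply: contraNT m_n0; rewrite negb_exists => /forallP m0.
  by apply/eqP/mnmP=> i; rewrite mnm0E; apply/eqP/negPn.
have mE : mpolyX K m = mpolyX K (mnm1 i) * mpolyX K (mnm_sub m (mnm1 i)).
  by rewrite -mpolyXD addmC submK // lep1mP.
exists (fun j => (i == j)%:R * (c *: mpolyX K (mnm_sub m (mnm1 i))) + q j).
have -> : ev0 (c *: mpolyX K m + p) = ev0 p.
  by rewrite /ev0 mevalD mevalZ mE mevalM mevalXU mul0r mulr0 add0r.
rewrite {1}pE addrCA; congr (_ + _); under [RHS]eq_bigr do rewrite mulrDr.
rewrite big_split /=; congr (_ + _).
rewrite (bigD1 i) //= big1 ?addr0 => [|j /negPf ji].
  by rewrite eqxx mul1r -scalerAr mE.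
by rewrite eq_sym ji mul0r mulr0.
Qed.

Let red_fun (x : Q) : K^o := ev0 (repr x).
(** The coefficient of [x_i], written as a partial derivative at 0 so that the Leibniz rule
    applies. *)
Let dpart_fun i (x : Q) : K^o := ev0 (mderiv i (repr x)).

Let red_proj p : red_fun (proj p) = ev0 p.
Proof.
have /square_idealP[q qE] : repr (proj p) - p \in @square_ideal K n.
  by apply/square_zero_proj_eq; rewrite square_zero_projK.
rewrite /red_fun -[repr _](subrK p) qE /ev0 mevalD.
rewrite raddf_sum big1 ?add0r // => i _ /=.
by rewrite mevalM rmorphXn /= mevalXU expr0n mulr0.
Qed.

(** Every term of the derivative of [q j * 'X_j ^+ 2] still contains a factor ['X_j], so it vanishes
    at 0. *)
Let dpart_proj i p : dpart_fun i (proj p) = ev0 (mderiv i p).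
Proof.
have /square_idealP[q qE] : repr (proj p) - p \in @square_ideal K n.
  by apply/square_zero_proj_eq; rewrite square_zero_projK.
rewrite /dpart_fun -[repr _](subrK p) qE /ev0 mderivD mevalD.
rewrite (linear_sum (mderiv i)) raddf_sum big1 ?add0r // => j _ /=.
rewrite mderivM mevalD !mevalM expr2 mderivM mevalD !mevalM mevalXU.
by rewrite !(mulr0, mul0r, addr0).
Qed.

Let projZ c p : proj (c *: p) = c *: proj p.
Proof. by rewrite -[RHS]/(square_zero_scale c _) square_zero_scaleE. Qed.

Let proj1 : proj 1 = 1. Proof. exact: rmorph1. Qed.

Let proj0 : proj 0 = 0. Proof. exact: rmorph0. Qed.

Let red_linear : linear red_fun.
Proof.
move=> c x y; rewrite -[x]square_zero_projK -[y]square_zero_projK -projZ.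
by rewrite -square_zero_projD !red_proj /ev0 mevalD mevalZ.
Qed.

Let red_mul : monoid_morphism red_fun.
Proof.
split; first by rewrite -proj1 red_proj /ev0 meval1.
move=> x y; rewrite -[x]square_zero_projK -[y]square_zero_projK.
by rewrite -square_zero_projM !red_proj /ev0 mevalM.
Qed.

Let dpart_linear i : linear (dpart_fun i).
Proof.
move=> c x y; rewrite -[x]square_zero_projK -[y]square_zero_projK -projZ.
by rewrite -square_zero_projD !dpart_proj /ev0 linearP mevalD mevalZ.
Qed.

Let inc_linear : linear ((fun c : K => c%:A : Q) : K^o -> Q).
Proof. by move=> c a b; rewrite scalerDl scalerA. Qed.

Let inc_mul : monoid_morphism ((fun c : K => c%:A : Q) : K^o -> Q).
Proof. by split=> [|a b]; rewrite ?scale1r // -scalerAl mul1r scalerA. Qed.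

Lemma square_zero_thickening : thickening K^o Q n.
Proof.
apply: (@Thickening _ _ _ _ (lrmorph_of inc_linear inc_mul)
  (lrmorph_of red_linear red_mul) (fun i => proj (mpolyX K (mnm1 i)))
  (fun i => lin_of (dpart_linear i))).
- move=> c; rewrite !lrmorph_ofE -proj1 -projZ red_proj.
  by rewrite /ev0 mevalZ meval1 mulr1.
- by move=> i x; rewrite mulrC.
- move=> i; exists 2%N; rewrite expr2 -square_zero_projM.
  rewrite -proj0; apply/square_zero_proj_eq/square_idealP.
  exists (fun j => (i == j)%:R); rewrite subr0 (bigD1 i) //= eqxx mul1r.
  by rewrite big1 ?addr0 ?expr2 // => j /negPf ji; rewrite eq_sym ji mul0r.
- by move=> i; rewrite lrmorph_ofE red_proj /ev0 mevalXU.
- move=> x; have [q qE] := mpoly_decomp (repr x); exists (fun i => proj (q i)).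
  rewrite !lrmorph_ofE -{1}[x]square_zero_projK {1}qE square_zero_projD projZ proj1.
  congr (_ + _).
  rewrite (big_morph proj (@square_zero_projD K n) proj0).
  by apply: eq_bigr => i _; rewrite square_zero_projM.
- move=> i x y; rewrite !lin_ofE !lrmorph_ofE.
  rewrite -[x]square_zero_projK -[y]square_zero_projK -square_zero_projM.
  by rewrite !dpart_proj !red_proj /ev0 mderivM mevalD !mevalM.
- move=> i j; rewrite lin_ofE dpart_proj /ev0 mderivX mevalZ.
  rewrite mnm1E eq_sym; have [->|] := eqVneq i j; last by rewrite mul0r.
  rewrite mul1r (_ : mnm_sub _ _ = mnm0) ?mpolyX0 ?meval1 //.
  by apply/mnmP=> k; rewrite mnmBE mnm0E subnn.
- move=> i c; rewrite lin_ofE lrmorph_ofE -proj1 -projZ dpart_proj.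
  have d1 : mderiv i (1 : mpoly n K) = 0 by rewrite -mpolyC1 mderivC.
  by rewrite /ev0 mderivZ mevalZ d1 meval0 mulr0.
Qed.

End SquareZeroThickening.

Theorem corollary3p9 (R : realType) (K : closedFieldType) :
  (forall (A : falgType K) (m : nat), (2 <= m)%N ->
     FPdim R (tensor A (truncated_poly K m)) = (FPdim R A + 1%:E)%E) /\
  (forall n : nat, (1 <= n)%N ->
     FPdim R (square_zero_alg K n) = (n%:R : R)%:E) /\
  (forall N : nat, exists A : falgType K, FPdim R A = (N%:R : R)%:E).
Proof.
(* Also proved for [n = 0], where the algebra is [K], so that the value 0 is attained as well. *)
have sq n : FPdim R (square_zero_alg K n) = (n%:R : R)%:E.
  by rewrite (FPdim_thickening R (square_zero_thickening K n)) FPdim_regular add0e.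
split.
  by move=> A m m_gt1; apply: FPdim_thickening (tensor_thickening m_gt1 A).
by split=> [n _|N]; [exact: sq | exists (square_zero_alg K N)].
Qed.
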